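(* Let $\Gamma=(V,E)$ be a finite layered graph with unique minimal vertex $*$ of level $0$ and let $\sigma$ be an automorphism of $\Gamma$. Let $V_\sigma=\{v\in V:\sigma(v)=v\}$, and let $Tr_\sigma(A(\Gamma),t)=\sum_{i\ge0}\dim\big(A(\Gamma^\sigma)_{[i]}\big)t^i$ be the Hilbert series of the subalgebra $A(\Gamma^\sigma)$ of $\mathrm{gr}A(\Gamma)$, which is the graded trace function of $\sigma$ acting on $A(\Gamma)$ (the coefficient of $t^i$ is, as an element of $k$, the trace of $\sigma$ on $A(\Gamma)_{[i]}$). Then $$Tr_\sigma(A(\Gamma),t)=\frac{1-t}{1-t\displaystyle\sum_{\substack{v_1>\cdots>v_l\ge *\\ v_1,\dots,v_l\in V_\sigma}}(-1)^{l-1}t^{|v_1|-|v_l|}},$$ where the sum is over all $l\ge1$ and all chains $v_1>\cdots>v_l$ of elements of $V_\sigma$ (the vertex $*$ is allowed).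
   Context: Let $k$ be a field. A layered graph $\Gamma=(V,E)$ is a directed graph with $V=\bigsqcup_{i=0}^nV_i$, $E=\bigsqcup_{i=1}^nE_i$, such that each edge $e\in E_i$ has tail $t(e)\in V_i$ and head $h(e)\in V_{i-1}$. Write $|v|=i$ for $v\in V_i$ (the level). Assume $V_0=\{*\}$ and that every $v\in V_+=\bigcup_{i\ge1}V_i$ is the tail of at least one edge; fix for each $v\in V_+$ a distinguished edge $e_v$ with tail $v$. A path $\pi=\{e_1,\dots,e_m\}$ is a sequence of edges with $t(e_{i+1})=h(e_i)$; $t(\pi)=t(e_1)$, $h(\pi)=h(e_m)$, $l(\pi)=m$. Write $v>w$ if there is a path from $v$ to $w$. For a path $\pi$ put $e(\pi,j)=\sum_{1\le i_1<\cdots<i_j\le m}e_{i_1}\cdots e_{i_j}$ in the free algebra $T(E)$. $A(\Gamma)=T(E)/R$, where $R$ is the two-sided ideal generated by all $e(\pi_1,j)-e(\pi_2,j)$ with $t(\pi_1)=t(\pi_2)$, $h(\pi_1)=h(\pi_2)$, $1\le j\le l(\pi_1)$. The distinguished path of $v\in V_+$ is $e_1=e_v$, $e_{i+1}=e_{h(e_i)}$, ending at $*$; $e(v,j)$ ($1\le j\le|v|$) denotes the class of $e_1\cdots e_j$. Write $(v,j)\gtrdot(w,l)$ if $v>w$ and $j=|v|-|w|$. $A(\Gamma)$ is graded by word length in the edges, $A(\Gamma)=\bigoplus_iA(\Gamma)_{[i]}$ (so $e(v,j)$ has degree $j$). Giving an edge in $E_i$ the weight $i$, $A(\Gamma)$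 also has the filtration $A(\Gamma)_{(i)}$ spanned by products of edges of total weight $\le i$; $\mathrm{gr}A(\Gamma)$ is the associated graded algebra of this filtration. It inherits the word-length grading, and $e(v,j)$ also denotes the corresponding element of $\mathrm{gr}A(\Gamma)$, namely the class of $e(v,j)$ modulo terms of weight lower than $|v|+(|v|-1)+\cdots+(|v|-j+1)$. An automorphism of $\Gamma$ is a permutation of the vertices preserving levels and the edge relation; it induces an automorphism of $A(\Gamma)$ by mapping (the class of) an edge from $v$ to $w$ to (the class of) an edge from $\sigma(v)$ to $\sigma(w)$. $A(\Gamma^\sigma)$ is the span in $\mathrm{gr}A(\Gamma)$ of the products $e(v_1,k_1)\cdots e(v_l,k_l)$ with $l\ge0$, $v_i\in V_\sigma\setminus\{*\}$, $1\le k_i\le|v_i|$, $(v_i,k_i)\not\gtrdot(v_{i+1},k_{i+1})$. These products form a basis of $A(\Gamma^\sigma)$, which is a subalgebra of $\mathrm{gr}A(\Gamma)$, graded by word length. *)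

(* Defs.v *)
From HB Require Import structures.
From mathcomp Require Import all_boot all_order all_algebra all_fingroup.
From mathcomp Require Import generic_quotient.
From mathcomp Require Import boolp.
From mathcomp Require Import monalg.

Set Implicit Arguments.
Unset Strict Implicit.
Unset Printing Implicit Defensive.

Import GRing.Theory.
Local Open Scope ring_scope.
Local Open Scope quotient_scope.

Section LinearAlgebra.
Variables (k : fieldType) (V : lmodType k).

Definition is_submod (S : V -> Prop) : Prop :=
  S 0 /\ forall (c : k) x y, S x -> S y -> S (c *: x + y).

Definition span (S : V -> Prop) (x : V) : Prop :=
  exists r : seq (k * V),
    (forall p, p \in r -> S p.2) /\ x = \sum_(p <- r) p.1 *: p.2.

Definition is_basis (S : V -> Prop) (n : nat) (b : 'I_n -> V) : Prop :=
  (forall c : 'I_n -> k, \sum_i c i *: b i = 0 -> forall i, c i = 0) /\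
  (forall x, S x <-> exists c : 'I_n -> k, x = \sum_i c i *: b i).

Definition has_dim (S : V -> Prop) (n : nat) : Prop :=
  exists b : 'I_n -> V, is_basis S b.

(* [S] is finite-dimensional and stable under [f], and the restriction of [f]
   to [S] has trace [c]. *)
Definition has_trace (S : V -> Prop) (f : V -> V) (c : k) : Prop :=
  exists (n : nat) (b : 'I_n -> V) (M : 'M[k]_n),
    [/\ is_basis S b,
        forall i, f (b i) = \sum_j M i j *: b j
      & \tr M = c].

Lemma span_submod S : is_submod (span S).
Proof.
split; first by exists [::]; split=> //; rewrite big_nil.
move=> c x y [r [rS ->]] [s [sS ->]].
exists ([seq (c * p.1, p.2) | p <- r] ++ s); split.
  by move=> p; rewrite mem_cat => /orP[/mapP[q qr ->]|/sS//]; exact: (rS q).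
rewrite big_cat big_map /= scaler_sumr; congr (_ + _).
by apply: eq_bigr => p _; rewrite scalerA.
Qed.

Lemma span_gen (S : V -> Prop) x : S x -> span S x.
Proof.
move=> Sx; exists [:: (1, x)]; split; last by rewrite big_seq1 scale1r.
by move=> p; rewrite inE => /eqP->.
Qed.

Lemma span_min (S T : V -> Prop) :
  is_submod T -> (forall x, S x -> T x) -> forall x, span S x -> T x.
Proof.
move=> [T0 TL] ST x [r [rS ->]].
elim: r rS => [|p r IHr] rS; first by rewrite big_nil.
rewrite big_cons; apply: TL; first by apply/ST/rS; rewrite inE eqxx.
by apply: IHr => q qr; apply: rS; rewrite inE qr orbT.
Qed.

End LinearAlgebra.

Lemma spanM (k : fieldType) (A : algType k) (S T U : A -> Prop) :
    (forall x y, S x -> T y -> U (x * y)) ->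
  forall x y, span S x -> span T y -> span U (x * y).
Proof.
move=> STU x y Sx Ty.
have [U0 UL] := span_submod U.
apply: (span_min (T := fun x => span U (x * y)) _ _ Sx).
  split=> [|c u v Uu Uv]; first by rewrite mul0r.
  by rewrite mulrDl -scalerAl; apply: UL.
move=> {x Sx} x Sx.
apply: (span_min (T := fun y => span U (x * y)) _ _ Ty).
  split=> [|c u v Uu Uv]; first by rewrite mulr0.
  by rewrite mulrDr -scalerAr; apply: UL.
by move=> {y Ty} y Ty; apply/span_gen/STU.
Qed.

Record tsideal (k : fieldType) (A : algType k) := TSIdeal {
  tsi_pred :> A -> Prop;
  tsi_submod : is_submod tsi_pred;
  tsi_mull : forall a x, tsi_pred x -> tsi_pred (a * x);
  tsi_mulr : forall x a, tsi_pred x -> tsi_pred (x * a);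
  tsi_proper : ~ tsi_pred 1
}.

Section QuotientAlgebra.
Variables (k : fieldType) (A : algType k) (I : tsideal A).

Definition tsi_mem : {pred A} := fun x => `[< I x >].

Lemma tsi_memP x : reflect (I x) (x \in tsi_mem).
Proof. exact: asboolP. Qed.

Fact tsi_zmod_closed : zmod_closed tsi_mem.
Proof.
have [I0 IL] := tsi_submod I; split; first exact/tsi_memP.
move=> x y /tsi_memP Ix /tsi_memP Iy; apply/tsi_memP.
by rewrite -scaleN1r addrC; apply: IL.
Qed.

HB.instance Definition _ := GRing.isZmodClosed.Build A tsi_mem tsi_zmod_closed.

Definition quot_alg : Type := Quotient.quot tsi_mem.

HB.instance Definition _ := GRing.Zmodule.on quot_alg.
HB.instance Definition _ := EqQuotient.on quot_alg.

Definition qclass (x : A) : quot_alg := \pi_quot_alg x.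

Lemma qclassP x y : qclass x = qclass y <-> I (x - y).
Proof.
split=> [/eqP|Ixy]; rewrite /qclass.
  by rewrite -Quotient.idealrBE => /tsi_memP.
by apply/eqP; rewrite -Quotient.idealrBE; apply/tsi_memP.
Qed.

Lemma qclass_surj (x : quot_alg) : {a : A | x = qclass a}.
Proof. by exists (repr x); rewrite /qclass reprK. Qed.

Fact qclass_is_zmod_morphism : zmod_morphism qclass.
Proof. by move=> x y; rewrite /qclass -pi_is_zmod_morphism. Qed.

HB.instance Definition _ :=
  GRing.isZmodMorphism.Build A quot_alg qclass qclass_is_zmod_morphism.

Definition qone : quot_alg := qclass 1.
Definition qmul (x y : quot_alg) : quot_alg := qclass (repr x * repr y).
Definition qscale (c : k) (x : quot_alg) : quot_alg := qclass (c *: repr x).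

Lemma qclassK x : I (repr (qclass x) - x).
Proof. by apply/qclassP; rewrite /qclass reprK. Qed.

Lemma qmulE x y : qmul (qclass x) (qclass y) = qclass (x * y).
Proof.
apply/qclassP; set x' := repr _; set y' := repr _.
have -> : x' * y' - x * y = 1 *: (x' * (y' - y)) + (x' - x) * y.
  by rewrite scale1r mulrBr mulrBl addrA subrK.
apply: (tsi_submod I).2; first exact/tsi_mull/qclassK.
exact/tsi_mulr/qclassK.
Qed.

Lemma qscaleE c x : qscale c (qclass x) = qclass (c *: x).
Proof.
apply/qclassP; rewrite -scalerBr -[_ *: _]addr0.
apply: (tsi_submod I).2; [exact: qclassK | exact: (tsi_submod I).1].
Qed.

Local Ltac lift_class x := let a := fresh x in have [a ->] := qclass_surj x.

Fact qmulA : associative qmul.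
Proof.
by move=> x y z; lift_class x; lift_class y; lift_class z; rewrite !qmulE mulrA.
Qed.

Fact qmul1 : left_id qone qmul.
Proof. by move=> x; lift_class x; rewrite qmulE mul1r. Qed.

Fact qmul1r : right_id qone qmul.
Proof. by move=> x; lift_class x; rewrite qmulE mulr1. Qed.

Fact qmulDl : left_distributive qmul +%R.
Proof.
move=> x y z; lift_class x; lift_class y; lift_class z.
by rewrite -raddfD !qmulE mulrDl raddfD.
Qed.

Fact qmulDr : right_distributive qmul +%R.
Proof.
move=> x y z; lift_class x; lift_class y; lift_class z.
by rewrite -raddfD !qmulE mulrDr raddfD.
Qed.

Fact qone_neq0 : qone != 0.
Proof.
apply/eqP; rewrite -(raddf0 qclass) => /qclassP.
by rewrite subr0; apply: tsi_proper.
Qed.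

HB.instance Definition _ := GRing.Zmodule_isNzRing.Build quot_alg
  qmulA qmul1 qmul1r qmulDl qmulDr qone_neq0.

Fact qscaleA a b x : qscale a (qscale b x) = qscale (a * b) x.
Proof. by lift_class x; rewrite !qscaleE scalerA. Qed.

Fact qscale1 : left_id 1 qscale.
Proof. by move=> x; lift_class x; rewrite qscaleE scale1r. Qed.

Fact qscaleDr : right_distributive qscale +%R.
Proof.
by move=> c x y; lift_class x; lift_class y; rewrite -raddfD !qscaleE scalerDr raddfD.
Qed.

Fact qscaleDl x : {morph qscale^~ x : a b / a + b}.
Proof. by move=> a b; lift_class x; rewrite !qscaleE scalerDl raddfD. Qed.

HB.instance Definition _ := GRing.Zmodule_isLmodule.Build k quot_alg
  qscaleA qscale1 qscaleDr qscaleDl.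

Fact qscaleAl (c : k) (x y : quot_alg) : c *: (x * y) = (c *: x) * y.
Proof.
lift_class x; lift_class y; rewrite /GRing.scale /GRing.mul /=.
by rewrite qmulE !qscaleE qmulE scalerAl.
Qed.

HB.instance Definition _ := GRing.Lmodule_isLalgebra.Build k quot_alg qscaleAl.

Fact qscaleAr (c : k) (x y : quot_alg) : c *: (x * y) = x * (c *: y).
Proof.
lift_class x; lift_class y; rewrite /GRing.scale /GRing.mul /=.
by rewrite qmulE !qscaleE qmulE scalerAr.
Qed.

HB.instance Definition _ := GRing.Lalgebra_isAlgebra.Build k quot_alg qscaleAr.

Fact qclass_is_monoid_morphism : monoid_morphism qclass.
Proof. by split=> // x y; rewrite -qmulE. Qed.

HB.instance Definition _ :=
  GRing.isMonoidMorphism.Build A quot_alg qclass qclass_is_monoid_morphism.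

Fact qclass_is_scalable : scalable qclass.
Proof. by move=> c x; rewrite -qscaleE. Qed.

HB.instance Definition _ :=
  GRing.isScalable.Build k A quot_alg *:%R qclass qclass_is_scalable.

End QuotientAlgebra.

Record filtration (k : fieldType) (A : algType k) := Filtration {
  fil :> nat -> A -> Prop;
  fil_submod : forall i, is_submod (fil i);
  fil_incr : forall i j x, (i <= j)%N -> fil i x -> fil j x;
  fil_one : fil 0 1;
  fil_mul : forall i j x y, fil i x -> fil j y -> fil (i + j) (x * y)
}.

(* The direct sum [⊕_i F_i], with the multiplication [F_i × F_j -> F_{i+j}], is
   realized as the set of polynomials [∑_i a_i X^i] over [A] with [a_i \in F_i];
   [gr A = ⊕_i F_i/F_{i-1}] (with [F_{-1} = 0]) is its quotient by the two-sided
   ideal [⊕_i F_{i-1}]. *)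

Section AssociatedGraded.
Variables (k : fieldType) (A : algType k) (F : filtration A).

Definition rees_pred : {pred {poly A}} := fun p => `[< forall i, F i p`_i >].

Lemma rees_predP (p : {poly A}) : reflect (forall i, F i p`_i) (p \in rees_pred).
Proof. exact: asboolP. Qed.

Lemma fil_sum i (T : Type) (r : seq T) (P : pred T) (f : T -> A) :
  (forall t, P t -> F i (f t)) -> F i (\sum_(t <- r | P t) f t).
Proof.
have [F0 FL] := fil_submod F i => Ff.
by apply: big_ind => // x y Fx Fy; rewrite -[x]scale1r; apply: FL.
Qed.

Fact rees_subring_closed : subring_closed rees_pred.
Proof.
split; first apply/rees_predP=> i.
- rewrite coef1; case: eqP => [->|_]; first exact: fil_one.
  exact: (fil_submod F i).1.
- move=> p q /rees_predP Fp /rees_predP Fq; apply/rees_predP=> i.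
  by rewrite coefB -scaleN1r addrC; apply: (fil_submod F i).2.
move=> p q /rees_predP Fp /rees_predP Fq; apply/rees_predP=> i.
rewrite coefM; apply: fil_sum => j _.
by have := fil_mul (Fp j) (Fq (i - j)%N); rewrite subnKC // -ltnS.
Qed.

HB.instance Definition _ :=
  GRing.isSubringClosed.Build {poly A} rees_pred rees_subring_closed.

Record rees : predArgType := Rees {
  rees_val :> {poly A};
  rees_valP : rees_val \in rees_pred
}.

HB.instance Definition _ := [isSub for rees_val].
HB.instance Definition _ := [Choice of rees by <:].
HB.instance Definition _ := [SubChoice_isSubNzRing of rees by <:].

Fact rees_scale_subproof (c : k) (p : rees) :
  (c%:A : A) *: rees_val p \in rees_pred.
Proof.
case: p => p /= /rees_predP Fp; apply/rees_predP=> i.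
rewrite coefZ mulr_algl -[_ *: _]addr0.
by apply: (fil_submod F i).2; [exact: Fp|exact: (fil_submod F i).1].
Qed.

Definition rees_scale (c : k) (p : rees) : rees :=
  Rees (rees_scale_subproof c p).

Fact rees_scaleA a b p : rees_scale a (rees_scale b p) = rees_scale (a * b) p.
Proof. by apply: val_inj; rewrite /= scalerA mulr_algl scalerA. Qed.

Fact rees_scale1 : left_id 1 rees_scale.
Proof. by move=> p; apply: val_inj; rewrite /= !scale1r. Qed.

Fact rees_scaleDr : right_distributive rees_scale +%R.
Proof. by move=> c p q; apply: val_inj; rewrite /= scalerDr. Qed.

Fact rees_scaleDl p : {morph rees_scale^~ p : a b / a + b}.
Proof. by move=> a b; apply: val_inj; rewrite /= !scalerDl. Qed.

HB.instance Definition _ := GRing.Zmodule_isLmodule.Build k rees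
  rees_scaleA rees_scale1 rees_scaleDr rees_scaleDl.

Fact rees_scaleAl (c : k) (p q : rees) : c *: (p * q) = (c *: p) * q.
Proof. by apply: val_inj; rewrite /= scalerAl. Qed.

HB.instance Definition _ := GRing.Lmodule_isLalgebra.Build k rees rees_scaleAl.

Fact rees_scaleAr (c : k) (p q : rees) : c *: (p * q) = p * (c *: q).
Proof.
apply: val_inj; apply/polyP=> i; rewrite /= coefZ mulr_algl !coefM.
rewrite scaler_sumr; apply: eq_bigr => j _.
by rewrite coefZ mulr_algl scalerAr.
Qed.

HB.instance Definition _ := GRing.Lalgebra_isAlgebra.Build k rees rees_scaleAr.

Definition fil_pred (i : nat) (x : A) : Prop :=
  if i is i'.+1 then F i' x else x = 0.

Lemma fil_pred_submod i : is_submod (fil_pred i).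
Proof.
case: i => [|i] /=; last exact: fil_submod.
by split=> // c x y -> ->; rewrite scaler0 addr0.
Qed.

Lemma fil_pred_mul i j x y :
  (F i x -> fil_pred j y -> fil_pred (i + j) (x * y)) /\
  (fil_pred i x -> F j y -> fil_pred (i + j) (x * y)).
Proof.
split.
  case: j => [|j] /= Fx; last by rewrite addnS; apply: fil_mul.
  by move=> ->; rewrite mulr0; apply: (fil_pred_submod _).1.
case: i => [|i] /=; last exact: fil_mul.
by move=> -> _; rewrite mul0r; apply: (fil_pred_submod _).1.
Qed.

Definition gr_ideal_pred (p : rees) : Prop :=
  forall i, fil_pred i (rees_val p)`_i.

Fact gr_ideal_submod : is_submod gr_ideal_pred.
Proof.
split=> [i|c p q Ip Iq i]; first by rewrite coef0; apply: (fil_pred_submod i).1.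
by rewrite coefD coefZ mulr_algl; apply: (fil_pred_submod i).2.
Qed.

Lemma fil_pred_sum i (T : Type) (r : seq T) (P : pred T) (f : T -> A) :
  (forall t, P t -> fil_pred i (f t)) -> fil_pred i (\sum_(t <- r | P t) f t).
Proof.
have [F0 FL] := fil_pred_submod i => Ff.
by apply: big_ind => // x y Fx Fy; rewrite -[x]scale1r; apply: FL.
Qed.

Fact gr_ideal_mull (p q : rees) : gr_ideal_pred q -> gr_ideal_pred (p * q).
Proof.
move=> Iq i; rewrite coefM; apply: fil_pred_sum => j _.
have /rees_predP Fp := rees_valP p.
have := (fil_pred_mul _ _ _ _).1 (Fp j) (Iq (i - j)%N).
by rewrite subnKC // -ltnS.
Qed.

Fact gr_ideal_mulr (p q : rees) : gr_ideal_pred p -> gr_ideal_pred (p * q).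
Proof.
move=> Ip i; rewrite coefM; apply: fil_pred_sum => j _.
have /rees_predP Fq := rees_valP q.
have := (fil_pred_mul _ _ _ _).2 (Ip j) (Fq (i - j)%N).
by rewrite subnKC // -ltnS.
Qed.

Fact gr_ideal_proper : ~ gr_ideal_pred 1.
Proof. by move/(_ 0%N); rewrite coef1 /= => /eqP; rewrite oner_eq0. Qed.

Definition gr_ideal : tsideal rees :=
  TSIdeal gr_ideal_submod gr_ideal_mull gr_ideal_mulr gr_ideal_proper.

Definition gr : algType k := quot_alg gr_ideal.

Fact monomial_subproof i a : F i a -> a *: 'X^i \in rees_pred.
Proof.
move=> Fa; apply/rees_predP=> j; rewrite coefZ coefXn.
by case: eqP => [->|_]; rewrite ?mulr1 ?mulr0 //; apply: (fil_submod F j).1.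
Qed.

(* The class of [a] in [F_i/F_{i-1}], as an element of [gr A]. *)
Definition gr_class i a (Fa : F i a) : gr :=
  qclass gr_ideal (Rees (monomial_subproof Fa)).

End AssociatedGraded.

(* Parallel edges are allowed; their classes in A(Γ) coincide (relations of
   degree 1). The existence of an edge out of every vertex other than the star
   is part of the choice of the distinguished edges. *)
Record layered_graph := LayeredGraph {
  vertex : finType;
  edge : finType;
  level : vertex -> nat;
  tail : edge -> vertex;
  head : edge -> vertex;
  level_edge : forall e, level (tail e) = (level (head e)).+1;
  star : vertex;
  level_eq0 : forall v, (level v == 0%N) = (v == star);
  dist_edge : {v : vertex | v != star} -> edge;
  tail_dist_edge : forall v, tail (dist_edge v) = val v
}.

Section LayeredGraphs.
Variable G : layered_graph.
Local Notation V := (vertex G).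
Local Notation E := (edge G).

Definition arc : rel V := fun v w => [exists e : E, (tail e == v) && (head e == w)].

(* There is a path with at least one edge from [v] to [w]. *)
Definition above : rel V := fun v w => [exists u, arc v u && connect arc u w].

Definition is_path (p : seq E) (v w : V) : bool :=
  if p is e :: p' then
    [&& tail e == v, path (fun f g => tail g == head f) e p'
      & head (last e p') == w]
  else false.

Fixpoint dist_path_rec (n : nat) (v : V) : seq E :=
  if n is n'.+1 then
    if insub v is Some u then
      dist_edge u :: dist_path_rec n' (head (dist_edge u))
    else [::]
  else [::].

Definition dist_path (v : V) : seq E := dist_path_rec (level v) v.

(* The relation (v,j) ⋗ (w,l). *)
Definition covers (x y : V * nat) : bool :=
  above x.1 y.1 && (x.2 == level x.1 - level y.1)%N.

Definition is_automorphism (s : {perm V}) : Prop :=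
  (forall v, level (s v) = level v) /\ (forall v w, arc (s v) (s w) = arc v w).

End LayeredGraphs.

Section LayeredAlgebra.
Variables (k : fieldType) (G : layered_graph).
Local Notation V := (vertex G).
Local Notation E := (edge G).

(* The free algebra T(E): the monoid algebra of the free monoid on [E]. *)
Definition free_alg : Type := {malg k[{fmonom E}]}.

HB.instance Definition _ := GRing.Lalgebra.on free_alg.

Fact free_alg_scaleAr (c : k) (x y : free_alg) : c *: (x * y) = x * (c *: y).
Proof.
apply/malgP=> m; rewrite mcoeffZ.
rewrite !(@mcoeffMlw _ _ (msupp x) (msupp y)) ?msuppZ_le ?fsubset_refl //.
rewrite mulr_sumr; apply: eq_bigr => m1 _.
rewrite mulr_sumr; apply: eq_bigr => m2 _.
by rewrite mcoeffZ mulrnAr mulrCA.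
Qed.

HB.instance Definition _ := GRing.Lalgebra_isAlgebra.Build k free_alg free_alg_scaleAr.

Definition edge_gen (e : E) : free_alg := mkmalgU (fmu e) 1.

(* e(π,j): a mask selects a subsequence i_1 < ... < i_j of the path. *)
Definition path_sum (p : seq E) (j : nat) : free_alg :=
  \sum_(m : (size p).-tuple bool | count id m == j)
    \prod_(e <- mask m p) edge_gen e.

Definition relator (x : free_alg) : Prop :=
  exists (p1 p2 : seq E) (v w : V) (j : nat),
    [/\ is_path p1 v w, is_path p2 v w, (1 <= j <= size p1)%N
      & x = path_sum p1 j - path_sum p2 j].

Definition relator_ideal_pred : free_alg -> Prop :=
  span (fun x => exists a r b, relator r /\ x = a * r * b).

Fact relator_ideal_mull a x : relator_ideal_pred x -> relator_ideal_pred (a * x).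
Proof.
move=> Rx; apply: (spanM (S := eq a) _ _ Rx); last exact: span_gen.
move=> _ _ <- [b [r [c [Rr ->]]]]; exists (a * b), r, c.
by split=> //; rewrite !mulrA.
Qed.

Fact relator_ideal_mulr x a : relator_ideal_pred x -> relator_ideal_pred (x * a).
Proof.
move=> Rx; apply: (spanM (T := eq a) _ Rx); last exact: span_gen.
move=> _ _ [b [r [c [Rr ->]]]] <-; exists b, r, (c * a).
by split=> //; rewrite !mulrA.
Qed.

Fact relator_ideal_proper : ~ relator_ideal_pred 1.
Proof.
pose eps : {rmorphism free_alg -> k} := @mcoeff (fmonom E) k (@mone (fmonom E)).
have eps_gen e : eps (edge_gen e) = 0.
  by rewrite /eps /= /edge_gen mcoeffU -val_eqE /= fmU fm1.
have eps_path p j : (0 < j)%N -> eps (path_sum p j) = 0.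
  move=> j_gt0; rewrite rmorph_sum big1 // => m /eqP mj.
  rewrite rmorph_prod; have : size (mask m p) = j by rewrite size_mask ?size_tuple.
  case: (mask m p) => [|e r _]; first by move=> j0; rewrite -j0 in j_gt0.
  by rewrite big_cons eps_gen mul0r.
suff eps0 x : relator_ideal_pred x -> eps x = 0.
  by move=> /eps0/eqP; rewrite rmorph1 oner_eq0.
apply: (span_min (T := fun x => eps x = 0)).
  split=> [|c y z ey ez]; first exact: rmorph0.
  by rewrite rmorphD -mulr_algl rmorphM ey ez mulr0 addr0.
move=> {}x [a [r [b [[p1 [p2 [v [w [j [_ _ /andP[j_gt0 _] ->]]]]]] ->]]]].
by rewrite !rmorphM rmorphB !eps_path // subr0 mulr0 mul0r.
Qed.

Definition relator_ideal : tsideal free_alg :=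
  TSIdeal (span_submod _) relator_ideal_mull relator_ideal_mulr
    relator_ideal_proper.

Definition layered_alg : algType k := quot_alg relator_ideal.

Definition edge_class (e : E) : layered_alg := qclass relator_ideal (edge_gen e).

Definition edge_word (s : seq E) : layered_alg := \prod_(e <- s) edge_class e.

Definition word_weight (s : seq E) : nat := (\sum_(e <- s) level (tail e))%N.

Definition length_part (i : nat) : layered_alg -> Prop :=
  span (fun x => exists s, size s = i /\ x = edge_word s).

Definition weight_fil_pred (i : nat) : layered_alg -> Prop :=
  span (fun x => exists s, (word_weight s <= i)%N /\ x = edge_word s).

Fact weight_fil_incr i j x :
  (i <= j)%N -> weight_fil_pred i x -> weight_fil_pred j x.
Proof.
move=> le_ij; apply: span_min; first exact: span_submod.
move=> {}x [s [ws ->]]; apply: span_gen; exists s; split=> //.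
exact: leq_trans le_ij.
Qed.

Fact weight_fil_one : weight_fil_pred 0 1.
Proof.
by apply: span_gen; exists [::]; rewrite /word_weight /edge_word !big_nil.
Qed.

Fact weight_fil_mul i j x y :
  weight_fil_pred i x -> weight_fil_pred j y -> weight_fil_pred (i + j) (x * y).
Proof.
apply: spanM => _ _ [s [ws ->]] [t [wt ->]]; exists (s ++ t).
by rewrite /word_weight /edge_word !big_cat leq_add.
Qed.

Definition weight_fil : filtration layered_alg :=
  Filtration (fun i => span_submod _) weight_fil_incr weight_fil_one
    weight_fil_mul.

Definition gr_alg : algType k := gr weight_fil.

(* The image of [⊕_w (F_w ∩ A_[i])] in [gr A(Γ) = ⊕_w F_w/F_{w-1}]. *)
Definition gr_length_part (i : nat) (x : gr_alg) : Prop :=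
  exists p : rees weight_fil,
    (forall w, length_part i (rees_val p)`_w) /\ x = qclass (gr_ideal _) p.

Definition dist_elt (v : V) (j : nat) : layered_alg :=
  edge_word (take j (dist_path v)).

Definition dist_weight (v : V) (j : nat) : nat := (\sum_(i < j) (level v - i))%N.

Lemma word_weight_dist_path (v : V) (j : nat) :
  word_weight (take j (dist_path v)) = dist_weight v j.
Proof.
rewrite /word_weight /dist_weight /dist_path.
suff main n (u : V) : level u = n ->
    (\sum_(e <- take j (dist_path_rec n u)) level (tail e) =
     \sum_(i < j) (n - i))%N by exact: main.
elim: n u j => [|n IHn] u j lev_u; first by rewrite big_nil big1.
case: j => [|j]; first by rewrite take0 big_nil big_ord0.
rewrite /=; case: insubP => [x _ val_x|]; last by rewrite negbK -level_eq0 lev_u.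
have tail_x : tail (dist_edge x) = u by rewrite tail_dist_edge.
have lev_h : level (head (dist_edge x)) = n.
  by have := level_edge (dist_edge x); rewrite tail_x lev_u => -[].
by rewrite big_cons big_ord_recl tail_x lev_u subn0 IHn.
Qed.

Fact dist_elt_fil (v : V) (j : nat) : weight_fil (dist_weight v j) (dist_elt v j).
Proof.
apply: span_gen; exists (take j (dist_path v)).
by rewrite word_weight_dist_path.
Qed.

(* [e(v,j)] as an element of [gr A(Γ)]. *)
Definition gr_dist_elt (v : V) (j : nat) : gr_alg := gr_class (dist_elt_fil v j).

Section Automorphism.
Variable s : {perm V}.

Definition fixed (v : V) : bool := s v == v.

Definition fixed_word (u : seq (V * nat)) : bool :=
  all (fun x => [&& fixed x.1, x.1 != star G & (1 <= x.2 <= level x.1)%N]) u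
  && sorted (fun x y => ~~ covers x y) u.

(* A(Γ^σ), for σ = [s] *)
Definition fixed_alg : gr_alg -> Prop :=
  span (fun x => exists u, fixed_word u /\
                           x = \prod_(y <- u) gr_dist_elt y.1 y.2).

Definition fixed_alg_part (i : nat) (x : gr_alg) : Prop :=
  fixed_alg x /\ gr_length_part i x.

Definition induced_automorphism (phi : {lrmorphism layered_alg -> layered_alg}) :
    Prop :=
  bijective phi /\
  forall e f : E, tail f = s (tail e) -> head f = s (head e) ->
    phi (edge_class e) = edge_class f.

End Automorphism.
End LayeredAlgebra.

(* The sum over the chains [v_1 > ... > v_(l+1)] of fixed vertices; as their
   vertices are distinct, all the chains have at most [#|V|] elements. *)
Definition fixed_chain_sum (G : layered_graph) (s : {perm vertex G}) : {poly int} :=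
  \sum_(l < #|vertex G|)
    \sum_(c : l.+1.-tuple (vertex G) | all (fixed s) c && sorted (@above G) c)
      (-1) ^+ l * 'X^(level (thead c) - level (last (thead c) c)).

(* The power series [∑_i a_i t^i] is the quotient [p / q] in Z[[t]]. *)
Definition is_expansion (a : nat -> int) (p q : {poly int}) : Prop :=
  q`_0 \is a GRing.unit /\
  forall n, \sum_(i < n.+1) a i * q`_(n - i) = p`_n.

(* Main.v *)
(* Let [P_v(t) = Π (1 + t e_i)] over the edges of a path from [v] to the star. An edge
   [e : v -> w] gives [P_v = (1 + t e) P_w], so [A(Γ)] is generated by the coefficients
   [ê(v,j)] of the [P_v], and these agree with the [e(v,j)] in [gr A(Γ)]. The words in the
   [ê(v,j)] without factors [(v,j) ⋗ (w,l)] ("normal" words) form a basis of [A(Γ)]: on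
   the space [W] they span formally, operators [T(v,j)] satisfying the relations are
   obtained as follows. With [Q_v(τ) = τ^|v| P_v(1/τ)], the relations say that for [v > w]
   every sequence in [W] killed by [Q_w(shift)] is killed by [Q_v(shift)]; this is a linear
   condition on the [T(v,j)], which can be solved by recursion on the level and the weight,
   with [T(v,j) u = (v,j) u] for all normal [(v,j) u]. A normal word applied to the empty
   word returns itself, which gives independence; the evaluation [W -> A(Γ)] intertwines
   the actions, which gives spanning. Keeping track of weights carries this over to
   [gr A(Γ)].

   The automorphism permutes the basis of words in the [ê(v,j)], so its trace counts the
   words in fixed vertices. If [H] is the series of these words, [G_v] that of the words
   starting at [v], and [Z_v] the signed sum over chains starting at [v], then
   [(1 - t) G_v = t H Z_v] by induction on the level, and [H = 1 + Σ G_v]. *)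

From HB Require Import structures.
From mathcomp Require Import all_boot all_order all_algebra all_fingroup.
From mathcomp Require Import generic_quotient finmap monalg zify ring.
Require Import Defs.

Set Implicit Arguments.
Unset Strict Implicit.
Unset Printing Implicit Defensive.

Import Order.TTheory GRing.Theory Num.Theory.
Local Open Scope ring_scope.

(** * Free modules and free algebras *)

Section LinearExtension.
Variables (k : fieldType) (K : choiceType).

Lemma malg_sum (x : {malg k[K]}) : x = \sum_(u <- msupp x) x@_u *: << u >>.
Proof.
rewrite {1}[x]monalgE; apply: eq_bigr => u _.
by apply/malgP => v; rewrite mcoeffZ !mcoeffU mulrnAr mulr1.
Qed.

Lemma malg_ind (P : {malg k[K]} -> Prop) :
  is_submod P -> (forall u, P << u >>) -> forall x, P x.
Proof.
move=> [P0 PL] PU x; rewrite [x]malg_sum; apply: big_ind => // [y z Py Pz|u _].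
  by rewrite -[y]scale1r; apply: PL.
by rewrite -[_ *: _]addr0; apply: PL.
Qed.

Variable M : lmodType k.

Definition lin (f : K -> M) (x : {malg k[K]}) : M :=
  \sum_(u <- msupp x) x@_u *: f u.

Lemma linEw f (d : {fset K}) x :
  (msupp x `<=` d)%fset -> lin f x = \sum_(u <- d) x@_u *: f u.
Proof.
move=> le; rewrite /lin (big_fset_incl _ le) //= => u _ /mcoeff_outdom ->.
by rewrite scale0r.
Qed.

Fact lin_is_linear f : linear (lin f).
Proof.
move=> c x y; pose d := (msupp x `|` msupp y)%fset.
have [dx dy] : (msupp x `<=` d /\ msupp y `<=` d)%fset.
  by split; [exact: fsubsetUl | exact: fsubsetUr].
have dz : (msupp (c *: x + y) `<=` d)%fset.
  apply: fsubset_trans (msuppD_le _ _) _; rewrite fsubUset dy andbT.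
  exact: fsubset_trans (msuppZ_le _ _) dx.
rewrite (linEw _ dx) (linEw _ dy) (linEw _ dz) scaler_sumr -big_split /=.
by apply: eq_bigr => u _; rewrite mcoeffD mcoeffZ scalerDl scalerA.
Qed.

HB.instance Definition _ f :=
  GRing.isLinear.Build k {malg k[K]} M *:%R (lin f) (lin_is_linear f).

Definition linext f : {linear {malg k[K]} -> M} := lin f.

Lemma linU f u : lin f << u >> = f u.
Proof. by rewrite (linEw _ msuppU_le) big_seq_fset1 mcoeffUU scale1r. Qed.

Lemma linextU f u : linext f << u >> = f u.
Proof. exact: linU. Qed.

Lemma malg_linear_eq (f g : {linear {malg k[K]} -> M}) :
  (forall u, f << u >> = g << u >>) -> f =1 g.
Proof.
move=> fg; apply: malg_ind => //; split=> [|c x y fx fy]; first by rewrite !raddf0.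
by rewrite !linearP fx fy.
Qed.

End LinearExtension.

Lemma sum_tuple_cons (R : nmodType) (T : finType) n (F : T -> n.-tuple T -> R) :
  \sum_(t : n.+1.-tuple T) F (thead t) [tuple of behead t] =
  \sum_x \sum_(t : n.-tuple T) F x t.
Proof.
pose h (p : T * n.-tuple T) : n.+1.-tuple T := [tuple of p.1 :: p.2].
rewrite (reindex h) /=; last first.
  exists (fun t : n.+1.-tuple T => (thead t, [tuple of behead t])) => [[b t]|t] _ /=.
    by congr (_, _); apply: val_inj.
  by rewrite [RHS]tuple_eta; apply: val_inj.
rewrite (pair_bigA _ (fun b t => F b t)) /=.
by apply: eq_bigr => p _; congr F; apply: val_inj.
Qed.

Lemma span_morphM (k : fieldType) (A B : algType k) (f : A -> B) (S : A -> Prop) :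
    linear f -> (forall x, span S x) ->
    (forall x y, S x -> S y -> f (x * y) = f x * f y) ->
  {morph f : x y / x * y}.
Proof.
move=> fL genS fM.
pose g : {linear A -> B} := HB.pack f (GRing.isLinear.Build k A B *:%R f fL).
have {}fM x y : S x -> S y -> g (x * y) = g x * g y by exact: fM.
suff : forall x y, g (x * y) = g x * g y by [].
move=> x y; apply: (span_min (T := fun x => g (x * y) = g x * g y) _ _ (genS x)).
  split=> [|c x1 x2 e1 e2]; first by rewrite mul0r raddf0 mul0r.
  by rewrite mulrDl -scalerAl !linearP e1 e2 mulrDl scalerAl.
move=> {}x Sx.
apply: (span_min (T := fun y => g (x * y) = g x * g y) _ _ (genS y)); last first.
  by move=> z; apply: fM.
split=> [|c x1 x2 e1 e2]; first by rewrite mulr0 raddf0 mulr0.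
by rewrite mulrDr -scalerAr !linearP e1 e2 mulrDr scalerAr.
Qed.

(* The instances that [free_alg k G] inherits from [{malg _}] are not syntactically
   those of an [algType], which makes unification very slow; naming the [algType]
   restores the generic instances. *)
Definition free_algT (k : fieldType) (G : layered_graph) : algType k := free_alg k G.

Section FreeAlgebra.
Variables (k : fieldType) (G : layered_graph).
Local Notation V := (vertex G).
Local Notation E := (edge G).
Local Notation T := (free_algT k G).

Definition gen (e : E) : T := edge_gen k e.
Definition psum (p : seq E) j : T := path_sum k p j.

Lemma prod_gen (s : seq E) : \prod_(e <- s) gen e = << FMonom s >>.
Proof.
change (\prod_(e <- s) edge_gen k e = << FMonom s >>); elim: s => [|e s IHs].
  by rewrite big_nil; apply/malgP => m; rewrite mcoeff1 mcoeffU1 /mone /one /= fmoneE eq_sym.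
rewrite big_cons IHs /edge_gen; apply: etrans (fgmulUU _ _ _ _) _.
by rewrite mulr1 /mmul /mul /= fmmulE fmuE.
Qed.

Lemma free_alg_ind (P : T -> Prop) :
  is_submod P -> (forall s : seq E, P (\prod_(e <- s) gen e)) -> forall x, P x.
Proof.
move=> PS PE; apply: malg_ind => // u.
by have := PE u; rewrite prod_gen fmK.
Qed.

Lemma psum0 (p : seq E) : psum p 0 = 1.
Proof.
change (path_sum k p 0 = 1).
rewrite /path_sum (bigD1 (nseq_tuple (size p) false)) ?count_nseq //= mask_false.
rewrite big_nil big1 ?addr0 // => m /andP[/eqP m0 /eqP[]].
apply: val_inj; rewrite /= -{2}(size_tuple m).
elim: (val m) m0 => //= b l IHl; case: b => //=; rewrite ?add0n //.
by move/IHl => <-.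
Qed.

Lemma psum_nil j : psum [::] j.+1 = 0.
Proof. by rewrite /psum /path_sum big1 // => m; rewrite (tuple0 m). Qed.

(** Masks are split by their first bit: a subsequence either skips [e] or starts with it. In
    coefficients this is P_{ep} = (1 + t e) P_p. *)
Lemma psum_cons e (p : seq E) j : psum (e :: p) j.+1 = psum p j.+1 + gen e * psum p j.
Proof.
change (path_sum k (e :: p) j.+1 = path_sum k p j.+1 + edge_gen k e * path_sum k p j).
rewrite /path_sum /= big_mkcond /=.
pose F b (t : (size p).-tuple bool) : T := if count id (b :: t) == j.+1 then
  \prod_(f <- mask (b :: t) (e :: p)) edge_gen k f else 0.
transitivity (\sum_(t : (size p).+1.-tuple bool) F (thead t) [tuple of behead t]).
  by apply: eq_bigr => t _; rewrite {1 2}[t]tuple_eta.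
rewrite sum_tuple_cons big_bool addrC {}/F /=; congr (_ + _); rewrite -big_mkcond //=.
by rewrite mulr_sumr; apply: eq_big => // t _; rewrite big_cons.
Qed.

Lemma psum_gt (p : seq E) j : (size p < j)%N -> psum p j = 0.
Proof.
elim: p j => [|e p IHp] [|j] //= lt_pj; first exact: psum_nil.
by rewrite psum_cons !IHp ?mulr0 ?addr0 //; lia.
Qed.

Section Lift.
Variables (B : algType k) (b : E -> B).

Definition free_ext : T -> B := lin (fun m : {fmonom E} => \prod_(e <- m) b e).

HB.instance Definition _ := GRing.Linear.on free_ext.

Lemma free_ext_linear : linear free_ext.
Proof. exact: lin_is_linear. Qed.

Lemma free_ext_prod s : free_ext (\prod_(e <- s) gen e) = \prod_(e <- s) b e.
Proof. by rewrite prod_gen /free_ext linU. Qed.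

Lemma free_ext_monoid : monoid_morphism free_ext.
Proof.
split; first by have := free_ext_prod [::]; rewrite !big_nil.
apply: (span_morphM (S := fun x => exists s, x = \prod_(e <- s) gen e)).
- exact: free_ext_linear.
- apply: free_alg_ind; first exact: span_submod.
  by move=> s; apply: span_gen; exists s.
by move=> _ _ [s ->] [t ->]; rewrite -big_cat !free_ext_prod big_cat.
Qed.

HB.instance Definition _ := GRing.isMonoidMorphism.Build T B free_ext free_ext_monoid.

End Lift.

End FreeAlgebra.

(** * The universal property of quotient algebras *)

Section QuotientLift.
Variables (k : fieldType) (A B : algType k) (I : tsideal A) (f : {lrmorphism A -> B}).
Hypothesis f0 : forall x, I x -> f x = 0.

Definition quot_lift (x : quot_alg I) : B := f (repr x).

Lemma quot_liftE x : quot_lift (qclass I x) = f x.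
Proof.
rewrite /quot_lift; apply/eqP; rewrite -subr_eq0 -raddfB; apply/eqP/f0.
exact: qclassK.
Qed.

Fact quot_lift_linear : linear quot_lift.
Proof.
move=> c x y; have [a ->] := qclass_surj x; have [b ->] := qclass_surj y.
by rewrite -linearP !quot_liftE linearP.
Qed.

Fact quot_lift_monoid : monoid_morphism quot_lift.
Proof.
split; first by rewrite -(rmorph1 (qclass I)) quot_liftE rmorph1.
move=> x y; have [a ->] := qclass_surj x; have [b ->] := qclass_surj y.
by rewrite -rmorphM !quot_liftE rmorphM.
Qed.

HB.instance Definition _ := GRing.isLinear.Build k (quot_alg I) B *:%R quot_lift
  quot_lift_linear.
HB.instance Definition _ := GRing.isMonoidMorphism.Build (quot_alg I) B quot_lift
  quot_lift_monoid.

Definition quot_lrmorphism : {lrmorphism quot_alg I -> B} := quot_lift.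

End QuotientLift.

(** * Layered graphs and the algebra A(Γ) *)

Section Order.
Variable G : layered_graph.
Local Notation V := (vertex G).
Local Notation E := (edge G).
Implicit Types (v w : V) (e : E).

Lemma arcP v w : reflect (exists e, tail e = v /\ head e = w) (arc v w).
Proof.
apply: (iffP existsP) => [[e /andP[/eqP tv /eqP hw]]|[e [<- <-]]]; exists e => //.
by rewrite !eqxx.
Qed.

Lemma arc_level v w : arc v w -> level v = (level w).+1.
Proof. by move/arcP => [e [<- <-]]; rewrite level_edge. Qed.

Lemma arc_above v w : arc v w -> above v w.
Proof. by move=> vw; apply/existsP; exists w; rewrite vw connect0. Qed.

Lemma above_arc_trans u v w : arc u v -> above v w -> above u w.
Proof.
move=> uv /existsP[x /andP[vx xw]]; apply/existsP; exists v; rewrite uv.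
exact: connect_trans (connect1 vx) xw.
Qed.

Lemma above_ind (P : V -> Prop) w :
  (forall v u, arc v u -> (u = w \/ (P u /\ above u w)) -> P v) ->
  forall v, above v w -> P v.
Proof.
move=> step v /existsP[u /andP[vu /connectP[p pu lp]]].
elim: p u v vu pu lp => [|x p IHp] u v vu /= pu lp.
  by apply: step vu _; left; rewrite lp.
have [ux xp] := andP pu; apply: step vu _; right; split; first exact: IHp ux xp lp.
by apply/existsP; exists x; rewrite ux; apply/connectP; exists p.
Qed.

Lemma above_trans u v w : above u v -> above v w -> above u w.
Proof.
move=> uv vw; move: u uv; apply: above_ind => u x ux.
by case=> [xv|[xw _]]; apply: above_arc_trans ux _; rewrite ?xv.
Qed.

Lemma above_level v w : above v w -> (level w < level v)%N.
Proof.
move: v; apply: above_ind => v u vu.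
by rewrite (arc_level vu); case=> [->//|[/ltnW]].
Qed.

Lemma level_gt0 v : (0 < level v)%N = (v != star G).
Proof. by rewrite lt0n level_eq0. Qed.

Lemma level_star : level (star G) = 0%N.
Proof. by apply/eqP; rewrite level_eq0. Qed.

Lemma dist_path_star : dist_path (star G) = [::].
Proof. by rewrite /dist_path level_star. Qed.

Lemma dist_path_cons v : v != star G ->
  exists e, tail e = v /\ dist_path v = e :: dist_path (head e).
Proof.
move=> v0; exists (dist_edge (Sub v v0)); rewrite tail_dist_edge; split=> //.
have := level_edge (dist_edge (Sub v v0)); rewrite tail_dist_edge /= => lv.
by rewrite /dist_path lv /= insubT.
Qed.

Lemma vertex_ind (P : V -> Prop) :
    P (star G) -> (forall v e, v != star G -> tail e = v ->
      dist_path v = e :: dist_path (head e) -> P (head e) -> P v) ->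
  forall v, P v.
Proof.
move=> P0 PS v; move: {2}(level v) (erefl (level v)) => n.
elim: n v => [|n IHn] v lv; first by move/eqP: lv; rewrite level_eq0 => /eqP->.
have v0 : v != star G by rewrite -level_gt0 lv.
have [e [te de]] := dist_path_cons v0; apply: (PS _ _ v0 te de); apply: IHn.
by have := level_edge e; rewrite te lv => -[].
Qed.

Lemma size_dist_path v : size (dist_path v) = level v.
Proof.
elim/vertex_ind: v => [|v e v0 te -> /= ->]; first by rewrite dist_path_star level_star.
by rewrite -te level_edge.
Qed.

Lemma above_star v : v != star G -> above v (star G).
Proof.
elim/vertex_ind: v => [|v e _ te _ IH _]; first by rewrite eqxx.
have ve : arc v (head e) by apply/arcP; exists e.
case: (eqVneq (head e) (star G)) => [eh|/IH]; last exact: above_arc_trans.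
by rewrite -eh; apply: arc_above.
Qed.

Lemma is_path_cons e (p : seq E) v w :
  is_path (e :: p) v w =
    (tail e == v) && (if p is [::] then head e == w else is_path p (head e) w).
Proof. by case: p => [|f p] //=; rewrite -andbA eq_sym. Qed.

Lemma dist_path_is_path v : v != star G -> is_path (dist_path v) v (star G).
Proof.
elim/vertex_ind: v => [|v e _ te -> IH _]; first by rewrite eqxx.
rewrite is_path_cons te eqxx /=; case: (eqVneq (head e) (star G)) => [eh|/IH].
  by rewrite eh dist_path_star.
by case: (dist_path _).
Qed.

Lemma size_path (p : seq E) v w : is_path p v w -> (size p + level w)%N = level v.
Proof.
elim: p v => // e p IHp v; rewrite is_path_cons => /andP[/eqP <-].
by rewrite level_edge; case: p IHp => [_ /eqP <-|f p IHp /IHp /= <-].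
Qed.

End Order.

Lemma qclass_linear (k : fieldType) (A : algType k) (I : tsideal A) :
  linear (qclass I : A -> quot_alg I).
Proof. by move=> c x y; rewrite linearP. Qed.

(** * The elements ê(v,j) of A(Γ) *)

Section LayeredAlgebraGenerators.
Variables (k : fieldType) (G : layered_graph).
Local Notation V := (vertex G).
Local Notation E := (edge G).
Local Notation A := (layered_alg k G).
Implicit Types (v w : V) (e : E).

Definition cls : {lrmorphism free_algT k G -> A} := qclass (relator_ideal k G).

Lemma cls_surj (x : A) : exists a : free_algT k G, x = cls a.
Proof. by have [a ->] := qclass_surj x; exists a. Qed.

Lemma cls_linear c (x y : free_algT k G) : cls (c *: x + y) = c *: cls x + cls y.
Proof. exact: qclass_linear. Qed.

Lemma clsM (x y : free_algT k G) : cls (x * y) = cls x * cls y.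
Proof. exact: (rmorphM cls). Qed.

Lemma cls1 : cls 1 = 1.
Proof. exact: (rmorph1 cls). Qed.

Definition path_class (p : seq E) j : A := cls (psum k p j).

(* Coefficient of [t^j] in [P_v(t)]; agrees with [e(v,j)] up to terms of lower weight. *)
Definition ehat v j : A := path_class (dist_path v) j.

Lemma path_class0 p : path_class p 0 = 1.
Proof. by rewrite /path_class psum0 rmorph1. Qed.

Lemma path_class_cons e p j :
  path_class (e :: p) j.+1 = path_class p j.+1 + edge_class k e * path_class p j.
Proof. by rewrite /path_class psum_cons rmorphD rmorphM. Qed.

Lemma path_class_gt p j : (size p < j)%N -> path_class p j = 0.
Proof. by move=> lt_pj; rewrite /path_class psum_gt ?raddf0. Qed.

(** The relators cover 1 <= j <= [size p]. Outside this range the classes agree too: they are 1 for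
    j = 0, and 0 beyond the length, which the endpoints determine. *)
Lemma path_class_eq p q v w j : is_path p v w -> is_path q v w ->
  path_class p j = path_class q j.
Proof.
move=> pP qP; case: (posnP j) => [->|j0]; first by rewrite !path_class0.
case: (leqP j (size p)) => [le_jp|lt_pj]; last first.
  rewrite !path_class_gt //.
  by move: (size_path pP) (size_path qP) lt_pj => <- /addIn ->.
apply/qclassP/span_gen; exists 1, (psum k p j - psum k q j), 1.
by split; [exists p, q, v, w, j; rewrite j0 | rewrite mul1r mulr1].
Qed.

Lemma ehat0 v : ehat v 0 = 1.
Proof. exact: path_class0. Qed.

Lemma ehat_gt v j : (level v < j)%N -> ehat v j = 0.
Proof. by move=> lt_vj; rewrite /ehat path_class_gt ?size_dist_path. Qed.

(** The distinguished path of [tail e], and [e] followed by the distinguished path of [head e], both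
    run from [tail e] to the star, so their classes agree. *)
Lemma ehat_edge e j :
  ehat (tail e) j.+1 = ehat (head e) j.+1 + edge_class k e * ehat (head e) j.
Proof.
rewrite -path_class_cons; apply: (@path_class_eq _ _ (tail e) (star G)).
  by apply: dist_path_is_path; rewrite -level_gt0 level_edge.
rewrite is_path_cons eqxx /=.
case: (eqVneq (head e) (star G)) => [eh|/dist_path_is_path].
  by rewrite eh dist_path_star.
by case: (dist_path _).
Qed.

Lemma edge_class_ehat e : edge_class k e = ehat (tail e) 1 - ehat (head e) 1.
Proof. by rewrite ehat_edge ehat0 mulr1 addrC addKr. Qed.

End LayeredAlgebraGenerators.

(** * Recurrences satisfied by the ê(v,j) *)

Section Recurrence.
Variables (G : layered_graph) (M : zmodType) (T : vertex G -> nat -> M -> M).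

(* With [Q_w(τ) = Σ_j T(w,j) τ^(|w|-j)], this says that the shift [S] of
   sequences satisfies [Q_w(S) g = 0]. *)
Definition recur (w : vertex G) (g : nat -> M) : Prop :=
  forall s, \sum_(j < (level w).+1) T w j (g (s + (level w - j))%N) = 0.

End Recurrence.

(** With S the shift, [fE] and the boundary values say that Σ f_j S^(n+1-j) = (S + e) Σ h_j S^(n-j),
    as coefficients commute with S. A sequence killed by the right factor is killed by the
    product. *)
Lemma recur_mul_linear (R : pzRingType) n (f h : nat -> R) e (g : nat -> R) :
    f 0%N = 1 -> h 0%N = 1 -> h n.+1 = 0 -> (forall j, f j.+1 = h j.+1 + e * h j) ->
    (forall s, \sum_(j < n.+1) h j * g (s + (n - j))%N = 0) ->
  forall s, \sum_(j < n.+2) f j * g (s + (n.+1 - j))%N = 0.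
Proof.
move=> f0 h0 hn fE hg s; rewrite big_ord_recl f0 mul1r subn0.
under eq_bigr => j _ do rewrite lift0 fE subSS mulrDl -mulrA.
rewrite big_split /= addrA -mulr_sumr hg mulr0 addr0 big_ord_recr /= hn mul0r addr0.
rewrite -[RHS](hg s.+1) big_ord_recl h0 mul1r subn0 addSnnS; congr (_ + _).
apply: eq_bigr => j _; rewrite lift0 addSnnS; congr (_ * g (_ + _)%N).
by have := ltn_ord j; lia.
Qed.

Section RecurrenceAlgebra.
Variables (k : fieldType) (G : layered_graph).

Definition ehat_mul (v : vertex G) j (x : layered_alg k G) := ehat k v j * x.

(** For one arc, [ehat_edge] gives Q_v(S) = (S + e) Q_u(S). This is the property that the operators
    on normal words are built to share. *)
Lemma ehat_recur (v w : vertex G) g :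
  above v w -> recur ehat_mul w g -> recur ehat_mul v g.
Proof.
move=> vw gw; move: v vw; apply: above_ind => v u vu IH.
have {IH gw w} : recur ehat_mul u g by case: IH => [->|[]].
have [e [<- <-]] := arcP _ _ vu => gu s; rewrite level_edge.
apply: (recur_mul_linear (h := ehat k (head e)) (e := edge_class k e)) gu s.
- exact: ehat0.
- exact: ehat0.
- exact: ehat_gt.
- exact: ehat_edge.
Qed.

End RecurrenceAlgebra.

(** * Recurrences *)

Section BasicSolutions.
Variables (k : fieldType) (G : layered_graph) (M : lmodType k).
Implicit Types (T : vertex G -> nat -> {linear M -> M}) (w : vertex G).

Local Notation recur T := (recur (fun v j => T v j : M -> M)).

Lemma recurP T w a g h : recur T w g -> recur T w h ->
  recur T w (fun c => a *: g c + h c).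
Proof.
move=> gw hw s; under eq_bigr => j _ do rewrite linearP.
by rewrite big_split -scaler_sumr /= gw hw scaler0 addr0.
Qed.

Lemma recur_sum T w (I : eqType) (r : seq I) (F : I -> nat -> M) :
  (forall i, i \in r -> recur T w (F i)) -> recur T w (fun c => \sum_(i <- r) F i c).
Proof.
elim: r => [|i r IHr] Fr s.
  by rewrite big1 // => j _; rewrite big_nil raddf0.
rewrite -[RHS](recurP 1 (Fr i (mem_head _ _)) (IHr _) s).
  by apply: eq_bigr => j _; rewrite big_cons scale1r.
by move=> h hr; apply: Fr; rewrite inE hr orbT.
Qed.

Lemma recur_ext T w g h : g =1 h -> recur T w g -> recur T w h.
Proof. by move=> gh gw s; rewrite -[RHS](gw s); apply: eq_bigr => j _; rewrite gh. Qed.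

(** As [T w 0] is the identity, Q_w is monic, so each value from index |w| on is determined by the
    |w| values before it. *)
Lemma recur_eq0 T w g : (forall x, T w 0 x = x) -> recur T w g ->
  (forall c, (c < level w)%N -> g c = 0) -> forall c, g c = 0.
Proof.
move=> T0 gw g0 c; elim/ltn_ind: c => c IHc.
case: (ltnP c (level w)) => [/g0//|le_wc].
have := gw (c - level w)%N; rewrite big_ord_recl T0 subn0 subnK // => /eqP.
rewrite addr_eq0 => /eqP->; rewrite big1 ?oppr0 // => j _; rewrite IHc ?raddf0 //.
by rewrite lift0; have := ltn_ord j; lia.
Qed.

Section Def.
Variables (T : vertex G -> nat -> {linear M -> M}) (w : vertex G) (i : nat) (z : M).

(* Values at [c-1, ..., 0] of the solution of [recur T w] with initial values
   [g_i = z] and [g_c = 0] for [c < |w|], [c != i]. *)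
Fixpoint rho_rec (c : nat) : seq M :=
  if c is c'.+1 then
    (if (c' < level w)%N then (if c' == i then z else 0)
     else - \sum_(j < level w) T w j.+1 (nth 0 (rho_rec c') j)) :: rho_rec c'
  else [::].

Definition rho (c : nat) : M := seq.head 0 (rho_rec c.+1).

Lemma nth_rho_rec c j : (j < c)%N -> nth 0 (rho_rec c) j = rho (c - j.+1).
Proof. by elim: c j => //= c IHc [|j] lt_jc; rewrite ?subn1 //= IHc. Qed.

Lemma rho_lt c : (c < level w)%N -> rho c = if c == i then z else 0.
Proof. by rewrite /rho /= => ->. Qed.

Lemma rho_ge c : (level w <= c)%N ->
  rho c = - \sum_(j < level w) T w j.+1 (rho (c - j.+1)).
Proof.
move=> le_wc; rewrite {1}/rho /= ltnNge le_wc /=; congr (- _).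
apply: eq_bigr => j _; rewrite nth_rho_rec //.
exact: leq_trans (ltn_ord j) le_wc.
Qed.

Lemma rho_recur : (forall x, T w 0 x = x) -> recur T w rho.
Proof.
move=> T0 s; rewrite big_ord_recl T0 subn0 [X in X + _]rho_ge ?leq_addl // addrC.
apply/eqP; rewrite subr_eq0; apply/eqP/eq_bigr => j _; rewrite lift0.
by congr (T w _ (rho _)); have := ltn_ord j; lia.
Qed.

End Def.

Lemma rho_ext T T' w i z c : (forall j x, T w j x = T' w j x) ->
  rho T w i z c = rho T' w i z c.
Proof.
move=> TT'; rewrite /rho; congr (seq.head _ _); elim: c.+1 => //= {}c ->.
by congr (_ :: _); case: ifP => // _; congr (- _); apply: eq_bigr.
Qed.

Lemma recur_rho T w g : (forall x, T w 0 x = x) -> recur T w g ->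
  forall c, g c = \sum_(i < level w) rho T w i (g i) c.
Proof.
move=> T0 gw c; apply/eqP; rewrite eq_sym -subr_eq0 -scaleN1r addrC; apply/eqP; move: c.
apply: (recur_eq0 T0).
  apply: recurP => //; apply: (recur_sum (F := fun i : 'I_(level w) => rho T w i (g i))).
  by move=> i _; apply: rho_recur.
move=> c lt_cw; rewrite (bigD1 (Ordinal lt_cw)) //= rho_lt // eqxx scaleN1r addKr.
by rewrite big1 // => j neq_jc; rewrite rho_lt // ifN // eq_sym.
Qed.

Lemma rho_sum T w i (I : eqType) (r : seq I) (a : I -> k) (x : I -> M) c :
  (forall x, T w 0 x = x) ->
  rho T w i (\sum_(h <- r) a h *: x h) c = \sum_(h <- r) a h *: rho T w i (x h) c.
Proof.
move=> T0; apply/eqP; rewrite -subr_eq0 addrC -scaleN1r; apply/eqP; move: c.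
apply: (recur_eq0 T0).
  apply: recurP; last exact: rho_recur.
  apply: (recur_sum (F := fun h c => a h *: rho T w i (x h) c)) => h _.
  apply: recur_ext (recurP (a h) (rho_recur i (x h) T0) (rho_recur i 0 T0)) => c.
  rewrite [rho T w i 0 c](recur_eq0 T0) ?addr0 //; first exact: rho_recur.
  by move=> c' /rho_lt->; case: ifP.
move=> c lt_cw; rewrite rho_lt // scaleN1r; under eq_bigr => h _ do rewrite rho_lt //.
by case: ifP => _; [rewrite addNr | rewrite big1 ?oppr0 ?addr0 // => h _; rewrite scaler0].
Qed.

(** At index |w| the recurrence meets the single nonzero initial value only through the operator of
    index |w| - i. So T(w,|w|-i) z can be read off from the solution, which turns a condition on
    solutions into an equation for the operators. *)
Lemma rho_level T w i z : (i < level w)%N ->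
  rho T w i z (level w) = - T w (level w - i)%N z.
Proof.
move=> lt_iw; rewrite rho_ge //; congr (- _).
have lt_jw : (level w - i.+1 < level w)%N by lia.
rewrite (bigD1 (Ordinal lt_jw)) //= [X in _ + X]big1 ?addr0 => [|j].
  have -> : (level w - i.+1).+1 = (level w - i)%N by lia.
  by rewrite subKn ?(ltnW lt_iw) // rho_lt // eqxx.
move=> /eqP neq_j; have lt_j := ltn_ord j; rewrite rho_lt; last by lia.
rewrite ifN ?raddf0 //; apply/eqP => eq_i; apply: neq_j; apply: val_inj => /=; lia.
Qed.

End BasicSolutions.

(** * Normal words and operators on them *)

(** The sum of 1, ..., c. For j <= |v| the weight of the letter (v,j) is the difference of these
    sums at |v| and at |v| - j, by [dist_weightE]. *)
Fixpoint triangular (c : nat) : nat := if c is c'.+1 then triangular c' + c else 0.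

Lemma leq_triangular b c : (b <= c)%N -> (triangular b <= triangular c)%N.
Proof.
elim: c => [|c IHc]; first by rewrite leqn0 => /eqP->.
by rewrite leq_eqVlt => /predU1P[->//|/IHc /=]; lia.
Qed.

(** The j largest of the integers 1, ..., b have a smaller sum than the j largest of 1, ..., c. This
    strictness is the drop in weight behind [homog_rho]. *)
Lemma triangular_lt b c j : (0 < j)%N -> (j <= b < c)%N ->
  (triangular b + triangular (c - j) < triangular c + triangular (b - j))%N.
Proof.
case: j => // j _; elim: j => [|j IHj] jbc.
  by case: b c jbc => [|b] [|c] jbc; rewrite ?subn1 /=; lia.
have /IHj : (j.+1 <= b < c)%N by lia.
have -> : (c - j.+1 = (c - j.+2).+1)%N by lia.
have -> /= : (b - j.+1 = (b - j.+2).+1)%N by lia.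
lia.
Qed.

Section Words.
Variable G : layered_graph.
Local Notation V := (vertex G).
Local Notation L := (V * nat)%type.
Implicit Types (x : L) (u : seq L).

Definition letter x : bool := (x.1 != star G) && (1 <= x.2 <= level x.1)%N.

Definition head_ok x u : bool := if u is y :: _ then ~~ covers x y else true.

Definition normal u : bool := all letter u && sorted (fun x y => ~~ covers x y) u.

Lemma normal_cons x u : normal (x :: u) = [&& letter x, head_ok x u & normal u].
Proof. by rewrite /normal; case: u => [|y u] /=; [rewrite !andbT | lia]. Qed.

Definition degree u : nat := \sum_(x <- u) x.2.
Definition weight u : nat := \sum_(x <- u) dist_weight x.1 x.2.

Lemma degree_cons x u : degree (x :: u) = (x.2 + degree u)%N.
Proof. by rewrite /degree big_cons. Qed.

Lemma weight_cons x u : weight (x :: u) = (dist_weight x.1 x.2 + weight u)%N.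
Proof. by rewrite /weight big_cons. Qed.

Lemma dist_weightE (v : V) j : (j <= level v)%N ->
  (dist_weight v j + triangular (level v - j) = triangular (level v))%N.
Proof.
rewrite /dist_weight; elim: j => [|j IHj] lt_jv; first by rewrite big_ord0 subn0.
rewrite big_ord_recr /= -IHj; last exact: ltnW.
have -> /= : (level v - j = (level v - j.+1).+1)%N by lia.
lia.
Qed.

End Words.

(** * The free module on the normal words *)

Section NormalWords.
Variables (k : fieldType) (G : layered_graph) (N : nat).
Hypothesis N_ge3 : (2 < N)%N.
Local Notation V := (vertex G).
Local Notation L := (V * nat)%type.

Definition nword : Type := {u : seq L | normal u}.
HB.instance Definition _ := Choice.on nword.

Local Notation W := {malg k[nword]}.

Definition word (u : seq L) : W := if insub u is Some u' then << (u' : nword) >> else 0.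

Lemma word_val (u : nword) : word (val u) = << u >>.
Proof. by rewrite /word valK. Qed.

Lemma word_normal u (nu : normal u) : word u = << (exist _ u nu : nword) >>.
Proof. by rewrite -word_val. Qed.

(* A well-founded measure for the rewriting: the factor [N] lets a drop of weight
   outweigh the additional letters. *)
Definition size_weight (u : seq L) : nat := N * weight u + size u.

Definition homog (d m : int) (x : W) : Prop :=
  forall u : nword, u \in msupp x ->
    (degree (val u))%:Z = d /\ ((size_weight (val u))%:Z <= m)%R.

Lemma homog_submod d m : is_submod (homog d m).
Proof.
split=> [u|c x y hx hy u]; first by rewrite msupp0.
move/(fsubsetP (msuppD_le _ _)); rewrite in_fsetU => /orP[|/hy//].
by move/(fsubsetP (msuppZ_le _ _)) => /hx.
Qed.

Lemma homog0 d m : homog d m 0.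
Proof. exact: (homog_submod d m).1. Qed.

Lemma homog_sum d m (I : Type) (r : seq I) (P : pred I) F :
  (forall i, P i -> homog d m (F i)) -> homog d m (\sum_(i <- r | P i) F i).
Proof.
move=> hF; apply: big_ind => //; first exact: homog0.
by move=> x y hx hy; rewrite -[x]scale1r; apply: (homog_submod d m).2.
Qed.

Lemma homogN d m x : homog d m x -> homog d m (- x).
Proof. by move=> hx u; rewrite msuppN; apply: hx. Qed.

Lemma homog_le d m m' x : (m <= m')%R -> homog d m x -> homog d m' x.
Proof. by move=> le_mm' hx u /hx[-> le]; split=> //; apply: le_trans le_mm'. Qed.

Lemma homog_word u d m : d = (degree u)%:Z -> (size_weight u)%:Z <= m -> homog d m (word u).
Proof.
move=> -> le_um u'; rewrite /word; case: insubP => [v _ uv|_]; last by rewrite msupp0.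
by rewrite msuppU oner_eq0 in_fset1 => /eqP ->; rewrite uv.
Qed.

Lemma homog_lin d m d' m' (f : nword -> W) x : homog d m x ->
  (forall u : nword, (degree (val u))%:Z = d -> (size_weight (val u))%:Z <= m ->
     homog d' m' (f u)) ->
  homog d' m' (lin f x).
Proof.
move=> hx hf; rewrite /lin big_seq_cond; apply: homog_sum => u; rewrite andbT => /hx[du mu].
by rewrite -[_ *: _]addr0; apply: (homog_submod _ _).2; [exact: hf | exact: homog0].
Qed.

Lemma eq_lin_supp (M : lmodType k) (f g : nword -> M) x :
  (forall u, u \in msupp x -> f u = g u) -> lin f x = lin g x.
Proof. by move=> fg; rewrite /lin; apply: eq_big_seq => u /fg->. Qed.

Section Position.
Variable T : V -> nat -> {linear W -> W}.

(** The index [b] is the power of the shift that accompanies the operator, so the letter meant is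
    (v,|v|-b). For b <= |v| it covers the first letter of [u] iff the vertex of that letter has
    level [b] and lies below [v]. *)
Definition redex (v : V) (b : nat) (u : seq L) : bool :=
  if u is x :: _ then above v x.1 && (level x.1 == b) else false.

(* [T (v, |v|-b) u], computed from the operators of lower levels: if [u = (w,l)u']
   with [v > w] and [|w| = b], the letters [(v,|v|-b)] and [(w,l)] are linked, and
   the value is read off from the requirement
   [Σ_c T (v,|v|-c) (rho w (b-l) u')_c = 0], whose [c = b] term is [- T (v,|v|-b) u]. *)
Fixpoint act_rec (f : nat) (v : V) (b : nat) (u : nword) : W :=
  if f is f'.+1 then
    if b == level v then << u >> else
    if redex v b (val u) then
      if val u is x :: u' then
        \sum_(c < (level v).+1 | c != b :> nat)
          lin (act_rec f' v c) (rho T x.1 (b - x.2) (word u') c)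
      else 0
    else word ((v, (level v - b)%N) :: val u)
  else 0.

(** For b <= |v|, the joint [size_weight] of (v,|v|-b) and [u], short of the 1 for the new letter.
    It decreases along the recursion of [act_rec] by [excess_rho] and therefore serves as fuel. *)
Definition excess (v : V) (b : nat) (u : nword) : nat :=
  size_weight (val u) + N * (triangular (level v) - triangular b).

Definition act (v : V) (b : nat) (u : nword) : W := act_rec (excess v b u).+1 v b u.

(** The operator costs no more than the letter (w,j): degree j, N times its weight, and 1 for its
    length when j > 0. *)
Definition bounded (w : V) : Prop :=
  forall j d m x, (j <= level w)%N -> homog d m x ->
    homog (d + j%:Z) (m + N%:Z * ((triangular (level w))%:Z - (triangular (level w - j))%:Z)
                      + (0 < j)%N%:Z) (T w j x).

(** Induction on [c]. One letter is gained at c = |w|; beyond |w| the strict convexity of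
    [triangular] more than makes up for the letters gained, and the bound improves by 1. *)
Lemma homog_rho (w : V) i z d m c : bounded w -> (i < level w)%N -> homog d m z ->
  homog (d + c%:Z - i%:Z)
    (m + N%:Z * ((triangular c)%:Z - (triangular i)%:Z)
     + (c == level w)%:Z - (level w < c)%N%:Z) (rho T w i z c).
Proof.
move=> bw lt_iw hz; elim/ltn_ind: c => c IHc.
case: (ltnP c (level w)) => [lt_cw|le_wc].
  rewrite rho_lt //; case: (eqVneq c i) => [->|_]; last exact: homog0.
  rewrite addrK subrr mulr0 addr0 ltn_eqF // ltnNge (ltnW lt_iw) /= subr0 addr0.
  exact: hz.
rewrite rho_ge //; apply/homogN/homog_sum => j _.
have lt_jc : (c - j.+1 < c)%N by have := ltn_ord j; lia.
have := bw j.+1 _ _ _ (ltn_ord j) (IHc _ lt_jc).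
have -> : d + (c - j.+1)%N%:Z - i%:Z + j.+1%:Z = d + c%:Z - i%:Z.
  by have := ltn_ord j; lia.
apply: homog_le; have lt_jw := ltn_ord j.
case: (ltngtP c (level w)) le_wc lt_jc => // [lt_wc|->] _ lt_jc.
  (* The drop is at least N >= 3, against one letter from [T w j.+1] and at most one already counted
     at c - j - 1; this leaves -1. *)
  have := @triangular_lt (level w) c j.+1 isT.
  rewrite lt_wc andbT => /(_ lt_jw).
  have : ((c - j.+1)%N == level w)%:Z - (level w < c - j.+1)%N%:Z <= 1 :> int by lia.
  nia.
have -> : ((level w - j.+1)%N == level w) = false by lia.
have -> : (level w < level w - j.+1)%N = false by lia.
lia.
Qed.

(** In the redex case the terms [triangular c] cancel between the solution at [c] and the operator
    T(v,|v|-c), so the bound does not depend on [c]. The removed letter (w,l) makes room for the new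
    one. *)
Lemma homog_act_rec f (v : V) b (u : nword) :
    (forall w, (level w < level v)%N -> bounded w) -> (b <= level v)%N ->
  homog ((degree (val u))%:Z + (level v - b)%N%:Z)
    ((size_weight (val u))%:Z + N%:Z * ((triangular (level v))%:Z - (triangular b)%:Z)
     + (b < level v)%N%:Z) (act_rec f v b u).
Proof.
move=> bT; elim: f b u => [|f IHf] b u le_bv; first exact: homog0.
rewrite /=; case: ifP => [/eqP->|/eqP neq_bv].
  by rewrite -word_val subnn addr0 subrr mulr0 ltnn !addr0; apply: homog_word.
have {neq_bv le_bv} lt_bv : (b < level v)%N by lia.
rewrite lt_bv; case: u => [[|[w l] u] nu] /=.
  apply: homog_word.
    by rewrite degree_cons /degree !big_nil /=; lia.
  rewrite /size_weight /= weight_cons /weight !big_nil /=.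
  have := @dist_weightE _ v (level v - b) (leq_subr _ _).
  by rewrite subKn ?(ltnW lt_bv) // => <-; nia.
case: ifP => [/andP[vw /eqP lw]|_]; last first.
  apply: homog_word; first by rewrite !degree_cons /=; lia.
  rewrite /size_weight !weight_cons /=.
  have := @dist_weightE _ v (level v - b) (leq_subr _ _).
  by rewrite subKn ?(ltnW lt_bv) // => <-; nia.
have := nu; rewrite normal_cons => /and3P[/andP[/= w0 lw12] _ nu'].
rewrite degree_cons /size_weight weight_cons /=.
have := @dist_weightE _ w l; rewrite lw => wE.
have {}wE := wE ltac:(lia).
apply: homog_sum => c /negP neq_cb; rewrite (word_normal nu').
have hu : homog (degree u)%:Z (size_weight u)%:Z << (exist _ u nu' : nword) >>.
  by rewrite -word_normal; apply: homog_word.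
have := @homog_rho w (b - l) _ _ _ c (bT _ (above_level vw)) ltac:(lia) hu.
move/homog_lin; apply=> u1 d1 m1.
have := IHf c u1 ltac:(by rewrite -ltnS).
rewrite d1; have -> : (degree u)%:Z + c%:Z - (b - l)%N%:Z + (level v - c)%N%:Z =
   (l + degree u)%N%:Z + (level v - b)%N%:Z.
  by have := ltn_ord c; lia.
apply: homog_le; move: m1; rewrite lw.
have -> : (c == b :> nat) = false by lia.
rewrite /size_weight; move: wE; nia.
Qed.

(** Removing (w,l) lowers the length by 1, and by [homog_rho] the solution gains a letter only at c
    = |w|, the index excluded here; the weight terms balance. *)
Lemma excess_rho (v w : V) l (u u' u1 : nword) c : bounded w -> above v w ->
    val u = (w, l) :: val u' -> (c <= level v)%N -> c != level w ->
    u1 \in msupp (rho T w (level w - l) << u' >> c) ->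
  (excess v c u1 < excess v (level w) u)%N.
Proof.
move=> bw /above_level lt_wv uE le_cv /negbTE neq_cw.
have := valP u; rewrite /= uE normal_cons => /and3P[/andP[/= _ lw12] _ _].
have hu : homog (degree (val u'))%:Z (size_weight (val u'))%:Z << u' >>.
  by rewrite -word_val; apply: homog_word.
have lt_lw : (level w - l < level w)%N by lia.
move=> /(homog_rho bw lt_lw hu)[_].
rewrite /excess uE /size_weight weight_cons /= neq_cw.
have := @dist_weightE _ w l => /(_ ltac:(lia)).
have := leq_triangular le_cv; have := leq_triangular (ltnW lt_wv).
nia.
Qed.

Lemma act_rec_fuel f f' (v : V) b (u : nword) :
    (forall w, (level w < level v)%N -> bounded w) -> (b <= level v)%N ->
    (excess v b u < f)%N -> (excess v b u < f')%N ->
  act_rec f v b u = act_rec f' v b u.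
Proof.
move=> bT; elim: f f' b u => [|f IHf] [|f'] b u le_bv //= lt_f lt_f'.
case: ifP => // /eqP neq_bv.
have {neq_bv le_bv} lt_bv : (b < level v)%N by lia.
case: u lt_f lt_f' => [[|[w l] u] nu] //= lt_f lt_f'.
case: ifP => // /andP[vw /eqP lw].
have := nu; rewrite normal_cons => /and3P[_ _ nu'].
apply: eq_bigr => c neq_cb; rewrite (word_normal nu') -lw.
apply: eq_lin_supp => u1 u1r.
have le_cv : (c <= level v)%N by rewrite -ltnS.
have lt1 : (excess v c u1 < excess v b (exist _ ((w, l) :: u) nu))%N.
  rewrite -[b]lw; apply: (excess_rho (bT _ (above_level vw)) vw) u1r => //=.
  by rewrite lw.
by apply: IHf => //; lia.
Qed.

Lemma act_top (v : V) (u : nword) : act v (level v) u = << u >>.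
Proof. by rewrite /act /= eqxx. Qed.

Lemma act_irred (v : V) b (u : nword) : (b < level v)%N -> ~~ redex v b (val u) ->
  act v b u = word ((v, (level v - b)%N) :: val u).
Proof. by move=> lt_bv /negbTE nr; rewrite /act /= ltn_eqF // nr. Qed.

Lemma act_redex (v w : V) l (u u' : nword) :
    (forall w, (level w < level v)%N -> bounded w) ->
    above v w -> val u = (w, l) :: val u' ->
  act v (level w) u = \sum_(c < (level v).+1 | c != level w :> nat)
    lin (act v c) (rho T w (level w - l) << u' >> c).
Proof.
move=> bT vw uE; have lt_wv := above_level vw.
rewrite {1}/act /= ltn_eqF // uE /= vw eqxx /=; apply: eq_bigr => c neq_cb.
rewrite word_val; apply: eq_lin_supp => u1 u1r.
have le_cv : (c <= level v)%N by rewrite -ltnS.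
by apply: act_rec_fuel => //; apply: excess_rho (bT _ lt_wv) vw uE le_cv neq_cb u1r.
Qed.

End Position.

End NormalWords.

(** * The operators T(v,j) and the relations between them *)

Section Operators.
Variables (k : fieldType) (G : layered_graph) (N : nat).
Hypothesis N_ge3 : (2 < N)%N.
Local Notation V := (vertex G).
Local Notation nword := (nword G).
Local Notation W := {malg k[nword]}.
Local Notation actN := (act (k := k) N).
Local Notation recur T := (recur (fun v j => T v j : W -> W)).

Lemma eq_act (T T' : V -> nat -> {linear W -> W}) v b u :
    (forall w, (level w < level v)%N -> forall j x, T w j x = T' w j x) ->
  actN T v b u = actN T' v b u.
Proof.
move=> TT'; rewrite /act; move: (excess N v b u).+1 => f.
elim: f b u; first by [].
move=> f IHf b [[|[w l] u'] nu]; rewrite /=; first by [].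
case: (b == level v); first by [].
case E: (above v w && (level w == b)); last by [].
apply: eq_bigr => c _.
case/andP: E => /above_level vw _.
rewrite (rho_ext _ _ _ (TT' w vw)).
rewrite /lin. apply: eq_bigr => u1 _; by rewrite IHf.
Qed.

(** Stage [n] is final for the vertices of level below [n], and later stages keep these; at higher
    levels the values are provisional. Since [act] at [v] consults only operators of vertices below
    [v], stage |v| + 1 is right at [v]. *)
Fixpoint op_rec (n : nat) (v : V) (j : nat) : {linear W -> W} :=
  if n is n'.+1 then
    if (level v < n')%N then op_rec n' v j
    else linext (fun u => if (level v < j)%N then 0
                          else actN (op_rec n') v (level v - j) u)
  else linext (fun _ => 0).

Definition op (v : V) : nat -> {linear W -> W} := op_rec (level v).+1 v.

Lemma op_recS n v j : op_rec n.+1 v j =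
  if (level v < n)%N then op_rec n v j
  else linext (fun u => if (level v < j)%N then 0
                        else actN (op_rec n) v (level v - j) u).
Proof. by []. Qed.

Lemma op_recE n v j : (level v < n)%N -> op_rec n v j = op v j.
Proof.
elim: n => [|n IHn]; first by discriminate.
rewrite ltnS leq_eqVlt => /predU1P[<-|lt_vn]; first by [].
by rewrite -IHn // op_recS lt_vn.
Qed.

Lemma op_basis v j u : op v j << u >> =
  if (level v < j)%N then 0 else actN op v (level v - j) u.
Proof.
rewrite /op op_recS ltnn linextU; case: (level v < j)%N; first by [].
by apply: eq_act => w wv i x; rewrite op_recE.
Qed.

Lemma op0 v x : op v 0 x = x.
Proof.
rewrite -[RHS]/((idfun : {linear W -> W}) x); apply: malg_linear_eq => u.
by rewrite op_basis /= subn0 act_top.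
Qed.

Lemma op_gt v j x : (level v < j)%N -> op v j x = 0.
Proof.
move=> lt_vj; rewrite -[RHS]/((\0 : {linear W -> W}) x); apply: malg_linear_eq => u.
by rewrite op_basis lt_vj.
Qed.

Lemma op_lin v c x : (c <= level v)%N -> op v (level v - c) x = lin (actN op v c) x.
Proof.
move=> le_cv; rewrite -[RHS]/(linext (actN op v c) x); apply: malg_linear_eq => u.
by rewrite op_basis ltnNge leq_subr subKn //= [RHS]linU.
Qed.

Lemma op_bounded v : bounded N op v.
Proof.
move: {2}(level v) (leqnn (level v)) => n; elim/ltn_ind: n v => n IHn v le_vn.
move=> j d m x le_jv hx.
have le_c : (level v - j <= level v)%N by exact: leq_subr.
rewrite -(subKn le_jv) op_lin // subKn //; apply: homog_lin hx _ => u du mu.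
have bT w : (level w < level v)%N -> bounded N op w.
  by move=> wv; apply: (IHn (level w)) => //; apply: leq_trans wv le_vn.
have := @homog_act_rec k G N N_ge3 op (excess N v (level v - j) u).+1 v
  (level v - j) u bT le_c.
rewrite subKn // du; apply: homog_le.
have -> : (level v - j < level v)%N = (0 < j)%N by lia.
lia.
Qed.

Lemma op_word x u : normal (x :: u) -> op x.1 x.2 (word k u) = word k (x :: u).
Proof.
rewrite normal_cons => /and3P[/andP[x0 /andP[j0 jx]] hx nu].
have nr : ~~ redex x.1 (level x.1 - x.2) u.
  case: u hx {nu} => //= y u; apply: contra => /andP[vy /eqP ly].
  by rewrite /covers vy ly subKn /=.
rewrite (word_normal k nu) op_basis ltnNge jx act_irred //.
  by rewrite subKn //= -surjective_pairing.
by rewrite -{2}(subn0 (level x.1)) ltn_sub2l // (leq_trans j0).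
Qed.

Section Vanishing.
Variable v : V.

(** The value at 0 of Q_v(S) g, summed by the power [c] of the shift. *)
Let Phi (g : nat -> W) : W := \sum_(c < (level v).+1) op v (level v - c) (g c).

Lemma PhiD g h : Phi (fun c => g c + h c) = Phi g + Phi h.
Proof. by rewrite -big_split; apply: eq_bigr => c _; rewrite raddfD. Qed.

Lemma Phi_recur w g :
    recur op w g ->
    (forall i u, (i < level w)%N -> u \in msupp (g i) -> Phi (rho op w i << u >>) = 0) ->
  Phi g = 0.
Proof.
move=> gw Pw; have T0 : forall x, op w 0 x = x by exact: op0.
transitivity (\sum_(i < level w) \sum_(u <- msupp (g i))
                (g i)@_u *: Phi (rho op w i << u >>)).
  rewrite /Phi; under eq_bigr => c _ do rewrite (recur_rho T0 gw) raddf_sum.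
  rewrite exchange_big; apply: eq_bigr => i _ /=.
  under [RHS]eq_bigr => u _ do rewrite scaler_sumr.
  rewrite [RHS]exchange_big; apply: eq_bigr => c _ /=.
  rewrite {1}[g i]malg_sum rho_sum // linear_sum.
  by apply: eq_bigr => u _; rewrite linearZZ.
apply: big1 => i _; rewrite big_seq big1 // => u ug.
by rewrite Pw ?scaler0.
Qed.

(* If [(w,|w|-i) :: u] is normal, this is the definition of [op v] on it. Otherwise
   [u = (w',l) :: u'] with [|w'| = i], and adding the solution for [w'] and [u']
   cancels the initial value [u], leaving initial values of smaller excess. *)
Lemma Phi_rho :
    (forall w u g, (level w < level v)%N -> above w u -> recur op u g -> recur op w g) ->
  forall w i u, above v w -> (i < level w)%N -> Phi (rho op w i << u >>) = 0.
Proof.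
(* Two nested inductions follow: on the level of [w], then on the excess of the initial word. *)
move=> IHv w; move: {2}(level w) (leqnn (level w)) => n.
elim/ltn_ind: n w => n IHn w le_wn i u vw.
have bT w' : (level w' < level v)%N -> bounded N op w' by move=> _; exact: op_bounded.
have lt_wv := above_level vw; have w0 : (0 < level w)%N -> w != star G by rewrite level_gt0.
have T0 : forall x, op w 0 x = x by exact: op0.
move: {2}(excess N v i u) (leqnn (excess N v i u)) => e.
elim/ltn_ind: e i u => e IHe i u le_e lt_iw.
have : head_ok (w, (level w - i)%N) (val u) \/ ~~ head_ok (w, (level w - i)%N) (val u).
  by case: head_ok; [left | right].
case=> [hu|].
  pose u1 := (w, (level w - i)%N) :: val u.
  have nu1 : normal u1.
    by rewrite normal_cons hu (valP u) /letter /= !andbT w0; lia.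
  have eq_v : (level w < (level v).+1)%N by lia.
  (* The term c = |w| is -T(v,|v|-|w|) applied to the normal word [u1], and [act_redex] expands it
     into minus the remaining terms. *)
  rewrite /Phi (bigD1 (Ordinal eq_v)) //= rho_level // -word_val.
  rewrite (@op_word (w, _) _ nu1) linearN op_lin 1?ltnW // (word_normal k nu1) linU.
  rewrite (@act_redex _ _ _ N_ge3 op v w (level w - i) _ u bT vw) // subKn 1?ltnW // addrC.
  apply/eqP.
  rewrite subr_eq0; apply/eqP; apply: eq_big => [c|c _]; first by rewrite -val_eqE.
  by rewrite word_val op_lin // -ltnS.
case: u le_e => [[|[w' l] u'] nu]; first by [].
rewrite /= negbK => le_e /andP[/= ww' /eqP ei].
have lt_w'w := above_level ww'.
have {}ei : i = level w' by lia.
have := nu; rewrite normal_cons => /and3P[/andP[/= w'0 lw12] _ nu'].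
pose z : W := << (exist _ u' nu' : nword) >>.
pose u : nword := exist _ ((w', l) :: u') nu.
(* The sequence [h] is the solution for Q_{w'} with initial value [u'] at |w'| - l. By the relations
   at the level |w| < |v| it is also one for Q_w, and its value at i = |w'| is -T(w',l) u' =
   -[u]. *)
have [h [hw hi h_lt Ph]] : exists h : nat -> W, [/\ recur op w h,
    h i = - << u >>,
    forall c, (c < level w)%N -> c != i -> forall u1, u1 \in msupp (h c) ->
      (excess N v c u1 < excess N v i u)%N
    & Phi h = 0].
  exists (rho op w' (level w' - l) z); split.
  - by apply: IHv lt_wv ww' _; apply: rho_recur; exact: op0.
  - rewrite ei rho_level; last by lia.
    rewrite subKn; last by case/andP: lw12.
    by rewrite /z -word_val (@op_word (w', l) u') // -word_val.
  - move=> c lt_cw neq_ci u1; rewrite /z ei.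
    have le_cv : (c <= level v)%N by lia.
    apply: (excess_rho N_ge3 (@op_bounded w') (above_trans vw ww')) => //.
    by rewrite -ei.
  by apply: (IHn (level w')) => //; [lia | exact: above_trans ww' | lia].
have [g0 g0E] : {g0 | g0 = rho op w i << u >>} by exists (rho op w i << u >>).
have gw : recur op w (fun c => g0 c + h c).
  move=> s; rewrite -[RHS](recurP 1 (rho_recur i << u >> T0) hw s) -g0E.
  by under [RHS]eq_bigr do rewrite scale1r.
change (Phi (rho op w i << u >>) = 0); rewrite -g0E.
have <- : Phi (fun c => g0 c + h c) = Phi g0 by rewrite PhiD Ph addr0.
apply: (Phi_recur gw) => i1 u1 lt_i1; rewrite g0E (rho_lt _ _ _ lt_i1).
case: (eqVneq i1 i) => [->|neq_i1]; first by rewrite hi subrr msupp0.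
rewrite add0r => u1h; have lt_i1' := lt_i1; apply: (IHe (excess N v i1 u1)) (leqnn _) lt_i1.
by apply: leq_trans le_e; apply: h_lt lt_i1' neq_i1 _ u1h.
Qed.

End Vanishing.

(** Induction on |v|. A shifted solution is again a solution, so only the sum at s = 0 matters; it
    is [Phi] of the shifted sequence. *)
Lemma op_recur v w g : above v w -> recur op w g -> recur op v g.
Proof.
move: {2}(level v) (leqnn (level v)) => n; elim/ltn_ind: n v w g => n IHn v w g le_vn vw gw s.
have IHv w1 u g1 : (level w1 < level v)%N -> above w1 u -> recur op u g1 -> recur op w1 g1.
  by move=> lt_w1; apply: (IHn (level w1)) => //; apply: leq_trans lt_w1 le_vn.
have gs : recur op w (fun c => g (s + c)%N).
  by move=> s'; rewrite -[RHS](gw (s + s')%N); apply: eq_bigr => j _; rewrite addnA.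
rewrite -[RHS](Phi_recur gs (fun i u lt_iw _ => Phi_rho IHv u vw lt_iw)).
rewrite (reindex_inj rev_ord_inj); apply: eq_bigr => j _ /=.
by rewrite subSS subKn // -ltnS.
Qed.

End Operators.

(** * The representation of A(Γ) and normal forms *)

Lemma span_action (k : fieldType) (A : algType k) (M : lmodType k)
    (f : A -> M -> M) (S : A -> Prop) :
    (forall z, linear (f^~ z)) -> (forall x, linear (f x)) -> (forall x, span S x) ->
    (forall x y z, S x -> S y -> f (x * y) z = f x (f y z)) ->
  forall x y z, f (x * y) z = f x (f y z).
Proof.
move=> fL fR genS fM x y z.
have f0 u : f 0 u = 0.
  by have := fL u 1 0 0; rewrite scaler0 addr0 scale1r -[LHS]addr0 => /addrI.
have f0r u : f u 0 = 0.
  by have := fR u 1 0 0; rewrite scaler0 addr0 scale1r -[LHS]addr0 => /addrI.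
apply: (span_min (T := fun x => f (x * y) z = f x (f y z)) _ _ (genS x)).
  split=> [|c x1 x2 e1 e2]; first by rewrite mul0r !f0.
  by rewrite mulrDl -scalerAl !fL e1 e2.
move=> {}x Sx.
apply: (span_min (T := fun y => f (x * y) z = f x (f y z)) _ _ (genS y)); last first.
  by move=> {}y Sy; apply: fM.
split=> [|c x1 x2 e1 e2]; first by rewrite mulr0 f0 f0r.
by rewrite mulrDr -scalerAr !fL fR e1 e2.
Qed.

(* Unification must not unfold these definitions when their arguments differ. *)
Opaque op psum.

Section Representation.
Variables (k : fieldType) (G : layered_graph) (N : nat).
Hypothesis N_ge3 : (2 < N)%N.
Local Notation V := (vertex G).
Local Notation E := (edge G).
Local Notation A := (layered_alg k G).
Local Notation T := (free_algT k G).
Local Notation nword := (nword G).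
Local Notation W := {malg k[nword]}.
Local Notation op := (op k N).
Local Notation recur T := (recur (fun v j => T v j : W -> W)).

(** Index 0 gives g_{m+1}, index 1 gives F_1 g_m, and below m the sequence can be nonzero only at m
    - j. It is applied to Q_v at s = 0 and to Q_w at s = 1, for the same [g]. *)
Lemma sum_op_delta m (F : nat -> {linear W -> W}) (g : nat -> W) j z :
    (forall x, F 0%N x = x) -> (0 < j <= m)%N ->
    (forall c, (c < m)%N -> g c = if c == (m - j)%N then z else 0) ->
  \sum_(c < m.+2) F c (g (m.+1 - c)%N) = g m.+1 + F 1%N (g m) + F j.+1 z.
Proof.
move=> F0 jm gm; rewrite 2!big_ord_recl F0 addrA !subn0; congr (_ + _ + _).
  by rewrite subn1.
have lt_jm : (j.-1 < m)%N by lia.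
rewrite (bigD1 (Ordinal lt_jm)) //= big1 ?addr0 => [|i /eqP neq_i].
  rewrite /bump !leq0n !add1n subSS prednK ?gm ?eqxx //; lia.
have lt_i := ltn_ord i; rewrite /bump !leq0n !add1n subSS gm; last by lia.
rewrite ifN ?linear0 //; apply/eqP => eq_i; apply: neq_i; apply: val_inj => /=; lia.
Qed.

(* [Q_v(S)] kills the basic solution of [Q_w(S) g = 0] with a single nonzero
   initial value [g_(|w|-j) = z]. *)
Lemma op_edge (e : E) j z : op (tail e) j.+1 z =
  op (head e) j.+1 z + (op (tail e) 1 (op (head e) j z) - op (head e) 1 (op (head e) j z)).
Proof.
have lv := level_edge e; set v := tail e in lv *; set w := head e in lv *.
have vw : above v w by apply: arc_above; apply/arcP; exists e.
case: (posnP j) => [->|j0]; first by rewrite op0 addrC subrK.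
case: (ltnP (level w) j) => [lt_wj|le_jw].
  by rewrite (op_gt N _ lt_wj) !linear0 !op_gt ?addr0 //; lia.
set m := level w in lv le_jw.
have [g [gm gw gv ge]] : exists g : nat -> W, [/\
    g m = - op w j z, recur op w g, recur op v g &
    forall c, (c < m)%N -> g c = if c == (m - j)%N then z else 0].
  exists (rho op w (m - j) z).
  have rw : recur op w (rho op w (m - j) z) by apply: rho_recur; exact: op0.
  split; [|exact: rw | exact: op_recur vw rw | by move=> c; apply: rho_lt].
  by rewrite rho_level ?subKn //; lia.
have jm : (0 < j <= m)%N by rewrite j0.
have s2 : \sum_(c < m.+2) op v c (g (m.+1 - c)%N) = 0.
  by have := gv 0%N; rewrite lv; apply: etrans.
have s1 : \sum_(c < m.+2) op w c (g (m.+1 - c)%N) = 0.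
  rewrite big_ord_recr /= op_gt // addr0 -[RHS](gw 1%N); apply: eq_bigr => c _.
  by congr (op w _ (g _)); rewrite -/m; have := ltn_ord c; lia.
rewrite (sum_op_delta (@op0 k G N w) jm ge) in s1.
rewrite (sum_op_delta (@op0 k G N v) jm ge) in s2.
(* Subtracting the two equations eliminates g_{m+1}, and g_m = -T(w,j) z leaves the claim. *)
move: s1 s2; rewrite gm !linearN => /eqP; rewrite addr_eq0 => /eqP s1 /eqP.
rewrite addr_eq0 => /eqP s2.
by rewrite -[op v j.+1 z]opprK -s2 -[op w j.+1 z]opprK -s1 !opprB [RHS]addrC [RHS]addrA subrK.
Qed.

Definition edge_op (e : E) (z : W) : W := op (tail e) 1 z - op (head e) 1 z.

Fact edge_op_linear e : linear (edge_op e).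
Proof.
move=> c x y; rewrite /edge_op (linearP (op (tail e) 1%N)) (linearP (op (head e) 1%N)).
by rewrite scalerBr opprD addrACA.
Qed.

HB.instance Definition _ e :=
  GRing.isLinear.Build k W W *:%R (edge_op e) (edge_op_linear e).

Lemma edge_op_mul e j z :
  op (tail e) j.+1 z = op (head e) j.+1 z + edge_op e (op (head e) j z).
Proof. exact: op_edge. Qed.

Definition word_act (s : seq E) (z : W) : W := foldr edge_op z s.

Fact word_act_linear s : linear (word_act s).
Proof. by elim: s => // e s IHs c x y; rewrite /= IHs edge_op_linear. Qed.

Definition act_free (x : T) (z : W) : W := lin (fun m : {fmonom E} => word_act m z) x.

Lemma act_free_linearl z : linear (act_free^~ z).
Proof. exact: lin_is_linear. Qed.

Lemma act_free_linearr x : linear (act_free x).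
Proof.
move=> c y z; rewrite /act_free /lin scaler_sumr -big_split /=; apply: eq_bigr => m _.
by rewrite word_act_linear scalerDr !scalerA mulrC.
Qed.

Lemma act_free_prod s z : act_free (\prod_(e <- s) gen k e) z = word_act s z.
Proof. by rewrite prod_gen /act_free linU. Qed.

Lemma act_freeM x y z : act_free (x * y) z = act_free x (act_free y z).
Proof.
apply: (span_action (S := fun x => exists s, x = \prod_(e <- s) gen k e)).
- exact: act_free_linearl.
- exact: act_free_linearr.
- apply: free_alg_ind; first exact: span_submod.
  by move=> s; apply: span_gen; exists s.
move=> _ _ z' [s ->] [t ->]; rewrite -big_cat !act_free_prod.
by rewrite /word_act foldr_cat.
Qed.

Lemma act_free1 z : act_free 1 z = z.
Proof. by have := act_free_prod [::] z; rewrite big_nil. Qed.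

Lemma act_free_gen e z : act_free (gen k e) z = edge_op e z.
Proof. by have := act_free_prod [:: e] z; rewrite big_seq1. Qed.

Lemma act_free0 z : act_free 0 z = 0.
Proof.
by have := act_free_linearl z 1 0 0; rewrite scaler0 addr0 scale1r -[LHS]addr0 => /addrI.
Qed.

Lemma act_free0r x : act_free x 0 = 0.
Proof.
by have := act_free_linearr x 1 0 0; rewrite scaler0 addr0 scale1r -[LHS]addr0 => /addrI.
Qed.

Lemma act_freeD x y z : act_free (x + y) z = act_free x z + act_free y z.
Proof. by have := act_free_linearl z 1 x y; rewrite !scale1r. Qed.

Lemma act_freeB x y z : act_free (x - y) z = act_free x z - act_free y z.
Proof. by rewrite addrC -scaleN1r act_free_linearl scaleN1r addrC. Qed.

Local Opaque act_free.

(** With T_v(t) = Σ T(v,j) t^j this is P_p(t) T_w(t) = T_v(t), by induction on the path from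
    [edge_op_mul]. The disjunction admits the empty path, which [is_path] excludes. *)
Lemma act_psum (p : seq E) v w : (p = [::] /\ v = w) \/ is_path p v w ->
  forall m z, \sum_(i < m.+1) act_free (psum k p i) (op w (m - i) z) = op v m z.
Proof.
elim: p v => [|e p IHp] v vw m z.
  case: vw => [[_ ->]|//]; rewrite big_ord_recl psum0 act_free1 subn0.
  by rewrite big1 ?addr0 // => i _; rewrite lift0 psum_nil act_free0.
have {vw} [<- pw] : tail e = v /\ ((p = [::] /\ head e = w) \/ is_path p (head e) w).
  case: vw => [[]|] //; rewrite is_path_cons => /andP[/eqP -> pw]; split=> //.
  by case: p pw {IHp} => [/eqP|f p]; [left | right].
have {}IHp := IHp _ pw; case: m => [|m].
  by rewrite big_ord_recl big_ord0 psum0 act_free1 !op0 addr0.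
rewrite edge_op_mul -IHp -(IHp m) [LHS]big_ord_recl [X in _ = X + _]big_ord_recl.
rewrite !psum0 !act_free1 !subn0 -addrA; congr (_ + _).
rewrite (linear_sum (edge_op e)) -big_split; apply: eq_bigr => i _ /=.
by rewrite /bump leq0n add1n subSS psum_cons act_freeD act_freeM act_free_gen.
Qed.

(** T_w(t) has constant term 1, so it can be cancelled from P_p T_w = T_v = P_q T_w; the induction
    on [j] performs the division. *)
Lemma act_psum_eq (p q : seq E) v w : is_path p v w -> is_path q v w ->
  forall j z, act_free (psum k p j) z = act_free (psum k q j) z.
Proof.
move=> pP qP j; elim/ltn_ind: j => j IHj z.
have E (r : seq E) : is_path r v w -> act_free (psum k r j) z =
    op v j z - \sum_(i < j) act_free (psum k r i) (op w (j - i) z).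
  move=> rP; rewrite -(act_psum (or_intror rP) j z) [X in X - _]big_ord_recr /=.
  by rewrite subnn op0 [RHS]addrC addKr.
apply: etrans (E p pP) (etrans _ (esym (E q qP))).
apply: (congr1 (fun x => op v j z - x)); apply: eq_bigr => i _.
by apply: IHj; exact: ltn_ord.
Qed.

Lemma act_psum_dist v j z : act_free (psum k (dist_path v) j) z = op v j z.
Proof.
rewrite -(@act_psum (dist_path v) v (star G)).
  rewrite big_ord_recr /= subnn op0 big1 ?add0r // => i _.
  by rewrite op_gt ?act_free0r // level_star subn_gt0.
case: (eqVneq v (star G)) => [->|/dist_path_is_path]; last by right.
by left; rewrite dist_path_star.
Qed.

Lemma act_relator_ideal x z : relator_ideal k G x -> act_free x z = 0.
Proof.
move: x; apply: span_min => [|_ [a [r [b [[p [q [v [w [j [pP qP _ ->]]]]]] ->]]]]].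
  split=> [|c x y ex ey]; first exact: act_free0.
  by have := act_free_linearl z c x y; rewrite /= ex ey scaler0 addr0.
change (act_free ((a : T) * (psum k p j - psum k q j) * (b : T)) z = 0).
by rewrite !act_freeM act_freeB (act_psum_eq pP qP) subrr act_free0r.
Qed.

(** The element applied to the empty word; the choice of representative does not matter because the
    relators act by 0. *)
Definition nf (x : A) : W := act_free (repr x) (word k [::]).

Lemma nf_qclass (x : T) : nf (cls k G x) = act_free x (word k [::]).
Proof.
apply/eqP; rewrite -subr_eq0 -act_freeB; apply/eqP/act_relator_ideal.
exact: (@qclassK k T (relator_ideal k G)).
Qed.

End Representation.

Opaque act_free.

Lemma sum_antidiagonal (M : nmodType) n (F : nat -> nat -> M) :
  \sum_(i < n.+1) F i (n - i)%N = \sum_(i < n.+1) F (n - i)%N i.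
Proof.
rewrite (reindex_inj rev_ord_inj); apply: eq_bigr => i _ /=.
by rewrite subSS subKn // -ltnS.
Qed.

Lemma linear_lin_mul (k : fieldType) (A : algType k) (K : choiceType)
    (h : {linear {malg k[K]} -> A}) (f : K -> {malg k[K]}) a x :
  (forall u, u \in msupp x -> h (f u) = a * h << u >>) -> h (lin f x) = a * h x.
Proof.
move=> hf; rewrite {2}[x]malg_sum /lin !linear_sum mulr_sumr.
by apply: eq_big_seq => u ux; rewrite !linearZ /= hf // scalerAr.
Qed.

(** * Evaluation in A(Γ) and normal forms as inverse maps *)

Section NormalForm.
Variables (k : fieldType) (G : layered_graph).
Local Notation V := (vertex G).
Local Notation E := (edge G).
Local Notation A := (layered_alg k G).
Local Notation nword := (nword G).
Local Notation W := {malg k[nword]}.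

Definition pword (u : seq (V * nat)) : A := \prod_(x <- u) ehat k x.1 x.2.

Definition theta : {linear W -> A} := linext (fun u : nword => pword (val u)).

Lemma thetaU u : theta << u >> = pword (val u).
Proof. exact: linU. Qed.

Lemma theta_word u : normal u -> theta (word k u) = pword u.
Proof. by move=> nu; rewrite (word_normal k nu) thetaU. Qed.

Local Opaque theta.

Lemma pword_cons x u : pword (x :: u) = ehat k x.1 x.2 * pword u.
Proof. exact: big_cons. Qed.

Variable N : nat.
Hypothesis N_ge3 : (2 < N)%N.
Local Notation op := (op k N).
Local Notation nf := (nf (k := k) (G := G) N).

Lemma nf_linear : linear nf.
Proof.
move=> c x y; have [a ->] := cls_surj x; have [b ->] := cls_surj y.
by rewrite -cls_linear !(nf_qclass N_ge3) act_free_linearl.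
Qed.

HB.instance Definition _ := GRing.isLinear.Build k A W *:%R nf nf_linear.

Lemma nf0 : nf 0 = 0.
Proof. exact: raddf0. Qed.

Lemma nf_qclassM (a : free_algT k G) x :
  nf (cls k G a * x) = act_free N a (nf x).
Proof.
by have [b ->] := cls_surj x; rewrite -clsM !(nf_qclass N_ge3) act_freeM.
Qed.

Lemma nf1 : nf 1 = word k [::].
Proof. by rewrite -cls1 (nf_qclass N_ge3) act_free1. Qed.

Lemma nf_edge e x : nf (edge_class k e * x) = edge_op N e (nf x).
Proof. by rewrite (nf_qclassM (gen k e)) act_free_gen. Qed.

Lemma nf_ehat v j x : nf (ehat k v j * x) = op v j (nf x).
Proof. by rewrite nf_qclassM act_psum_dist. Qed.

(** This gives independence: the representation recovers each normal word from its value in A(Γ). *)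
Lemma nf_pword u : normal u -> nf (pword u) = word k u.
Proof.
elim: u => [|x u IHu] nu; first by rewrite [pword _]big_nil nf1.
rewrite pword_cons nf_ehat IHu ?op_word //.
by move: nu; rewrite normal_cons => /and3P[].
Qed.

(** If evaluation intertwines the operators at [w], it carries a solution for Q_w in W to one in
    A(Γ), which by [ehat_recur] is a solution for Q_v. *)
Lemma theta_rho v w i0 z (T := fun v j => op v j : {linear W -> W}) :
    (forall j x, theta (op w j x) = ehat k w j * theta x) -> above v w ->
  \sum_(c < (level v).+1) ehat k v (level v - c) * theta (rho T w i0 z c) = 0.
Proof.
move=> thw vw.
have rw : recur (@ehat_mul k G) w (fun c => theta (rho T w i0 z c)).
  move=> s; have T0 x : T w 0 x = x by exact: op0.
  have := congr1 theta (rho_recur i0 z T0 s); rewrite raddf0 raddf_sum => rs.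
  by rewrite -[RHS]rs; apply: eq_bigr => j _; exact: esym (thw _ _).
rewrite -(sum_antidiagonal _ (fun i c => ehat k v i * theta (rho T w i0 z c))).
exact: (ehat_recur vw rw 0%N).
Qed.

(** Induction on |v|, then on the excess. In the redex case [act_redex] and [theta_rho] express both
    sides by the same sum over c != |w|, whose terms have smaller excess. *)
Lemma theta_op v j x : theta (op v j x) = ehat k v j * theta x.
Proof.
move: {2}(level v) (leqnn (level v)) => n; elim/ltn_ind: n v j x => n IHn v j x le_vn.
elim/malg_ind: x.
  split=> [|c x y ex ey]; first by rewrite !raddf0 mulr0.
  by rewrite !linearP /= ex ey mulrDr scalerAr.
move=> u; case: (ltnP (level v) j) => [lt_vj|le_jv].
  by rewrite op_gt // ehat_gt // mul0r raddf0.
have le_b : (level v - j <= level v)%N by exact: leq_subr.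
rewrite -(subKn le_jv) op_lin // linU.
move: (level v - j)%N le_b => b {j le_jv}.
move: {2}(excess N v b u) (leqnn (excess N v b u)) => e.
elim/ltn_ind: e b u => e IHe b u le_e; rewrite leq_eqVlt => /predU1P[->|lt_bv].
  by rewrite act_top subnn ehat0 mul1r.
case rb: (redex v b (val u)); last first.
  have hu : head_ok (v, (level v - b)%N) (val u).
    case: (val u) rb => // y u' rb; apply/negP => /andP[/= vy /eqP ey].
    by move/negP: rb; case; rewrite /= vy /=; have := above_level vy; lia.
  have nvu : normal ((v, (level v - b)%N) :: val u).
    rewrite normal_cons hu (valP u) !andbT /letter /= -level_gt0 subn_gt0 lt_bv.
    by rewrite leq_subr (leq_ltn_trans (leq0n b)).
  by rewrite act_irred ?rb // thetaU (theta_word nvu) pword_cons.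
have := valP u; case eu: (val u) rb => [|[w l] u'] //= /andP[vw /eqP lw].
rewrite normal_cons => /and3P[/andP[/= w0 lw12] _ nu'].
pose t : nword := exist _ u' nu'; have lt_wv := above_level vw.
have le_wv : (level w <= level v)%N by exact: ltnW.
have {}eu : val u = (w, l) :: val t by [].
have bT (w' : V) : (level w' < level v)%N -> bounded N op w' by move=> _; exact: op_bounded.
have thw : forall j x, theta (op w j x) = ehat k w j * theta x.
  by move=> j x; apply: (IHn (level w)) => //; apply: leq_trans lt_wv le_vn.
rewrite -lw (@act_redex k G N N_ge3 op v w l u t bT vw eu) linear_sum.
have lt_wv' : (level w < (level v).+1)%N by [].
have := theta_rho (level w - l) << t >> thw vw; rewrite (bigD1 (Ordinal lt_wv')) //=.
rewrite rho_level; last by lia.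
rewrite subKn; last by case/andP: lw12.
rewrite linearN thw mulrN => /eqP; rewrite addrC subr_eq0 => /eqP eq_sum.
rewrite [in RHS]thetaU eu pword_cons -thetaU -eq_sum.
apply: eq_big => [c|c neq_c]; first by rewrite -val_eqE.
have le_cv : (c <= level v)%N by rewrite -ltnS.
apply: linear_lin_mul => u1 u1r.
have lt_e := excess_rho N_ge3 (@op_bounded k G N N_ge3 w) vw eu le_cv neq_c u1r.
by apply: (IHe (excess N v c u1)) => //; apply: leq_trans lt_e _; rewrite lw.
Qed.

Lemma theta_edge e z : theta (edge_op N e z) = edge_class k e * theta z.
Proof. by rewrite linearB !theta_op -mulrBl -edge_class_ehat. Qed.

Lemma theta_act_free (x : free_algT k G) z :
  theta (act_free N x z) = cls k G x * theta z.
Proof.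
elim/free_alg_ind: x.
  split=> [|c x y ex ey]; first by rewrite act_free0 !raddf0 mul0r.
  rewrite act_free_linearl; apply: etrans (linearP theta _ _ _) _.
  apply: etrans (congr2 (fun a b => c *: a + b) ex ey) _.
  by rewrite cls_linear mulrDl scalerAl.
move=> s; rewrite act_free_prod.
elim: s => [|e s IHs]; first by rewrite big_nil cls1 mul1r.
by rewrite big_cons clsM -mulrA -IHs -theta_edge.
Qed.

Lemma theta_nf x : theta (nf x) = x.
Proof.
have [a ->] := cls_surj x.
by rewrite (nf_qclass N_ge3) theta_act_free theta_word // [pword _]big_nil mulr1.
Qed.

Lemma homog_edge_op e d m (z : W) : homog N d m z ->
  homog N (d + 1) (m + (N * level (tail e))%N%:Z + 1) (edge_op N e z).
Proof.
move=> hz.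
have -> : edge_op N e z = (-1) *: op (head e) 1 z + op (tail e) 1 z.
  by rewrite scaleN1r addrC.
have le v : (level v <= level (tail e))%N ->
    homog N (d + 1) (m + (N * level (tail e))%N%:Z + 1) (op v 1 z).
  move=> le_v; case: (posnP (level v)) => [v0|v0].
    by rewrite op_gt ?v0 //; apply: homog0.
  have := @op_bounded k G N N_ge3 v 1 _ _ _ v0 hz; apply: homog_le.
  by move: le_v; case: (level v) v0 => // n _; rewrite subn1 /=; nia.
case: (@homog_submod k G N (d + 1) (m + (N * level (tail e))%N%:Z + 1)) => _.
by apply; apply: le => //; rewrite level_edge.
Qed.

Lemma homog_nf_word (s : seq E) :
  homog N (size s)%:Z (N * word_weight s + size s)%N%:Z (nf (edge_word k s)).
Proof.
rewrite /edge_word /word_weight; elim: s => [|e s IHs].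
  rewrite !big_nil nf1.
  by apply: homog_word; rewrite /degree /size_weight /weight ?big_nil //=; lia.
rewrite !big_cons nf_edge.
have := @homog_edge_op e _ _ _ IHs; rewrite -[(size s)%:Z + 1]/((size s + 1)%N%:Z) addn1.
apply: homog_le => /=; lia.
Qed.

Lemma nf_length_part i x u : length_part i x -> u \in msupp (nf x) -> degree (val u) = i.
Proof.
move=> xi; move: x xi u; apply: span_min => [|_ [s [<- ->]] u us].
  split=> [|c x y hx hy] u; first by rewrite raddf0 msupp0.
  rewrite nf_linear => /(fsubsetP (msuppD_le _ _)); rewrite in_fsetU => /orP[|/hy//].
  by move/(fsubsetP (msuppZ_le _ _)) => /hx.
by have [[]] := homog_nf_word us.
Qed.

Lemma nfB x y : nf (x - y) = nf x - nf y.
Proof. exact: raddfB. Qed.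

Lemma nf_lin_comb (r : seq nword) (P : pred nword) (c : nword -> k) :
  nf (\sum_(u <- r | P u) c u *: pword (val u)) = \sum_(u <- r | P u) c u *: << u >>.
Proof.
elim: r => [|u r IHr]; first by rewrite !big_nil nf0.
rewrite !big_cons; case: ifP => // _; rewrite nf_linear nf_pword ?word_val ?IHr //.
exact: (valP u).
Qed.

End NormalForm.

(* A word of length [m] and weight at most [i] raises [size_weight] by at most
   [N i + m], so that weights are controlled as soon as [N > m]. *)
Lemma nf_weight_fil k G i (x : layered_alg k G) : weight_fil_pred i x ->
  exists N0, forall N u, (N0 < N)%N -> (2 < N)%N ->
    u \in msupp (nf N x) -> (weight (val u) <= i)%N.
Proof.
move: x; apply: span_min => [|_ [s [ws ->]]].
  split=> [|c x y [N1 h1] [N2 h2]].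
    by exists 0%N => N u _ N2; rewrite nf0 // msupp0.
  exists (maxn N1 N2) => N u; rewrite gtn_max => /andP[lt1 lt2] N2_; rewrite nf_linear //.
  move/(fsubsetP (msuppD_le _ _)); rewrite in_fsetU => /orP[|]; last exact: h2.
  by move/(fsubsetP (msuppZ_le _ _)); apply: h1.
exists (size s) => N u lt_s N2 us; have [_] := homog_nf_word N2 us.
rewrite /size_weight lez_nat => le_w; apply: leq_trans ws; rewrite -ltnS.
have N_gt0 : (0 < N)%N by lia.
rewrite -(ltn_pmul2l N_gt0) mulnS; move: le_w lt_s.
move: (N * _)%N (size (val u)) (N * _)%N (size s) => a b c d. lia.
Qed.

(** * The associated graded algebra *)

Lemma mcoeff_sum_cond (k : fieldType) (K : choiceType) (y : {malg k[K]}) (P : pred K) u :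
  P u -> (\sum_(v <- msupp y | P v) y@_v *: << v >>)@_u = y@_u.
Proof.
move=> Pu; rewrite raddf_sum {3}[y]malg_sum raddf_sum big_mkcond /=.
apply: eq_bigr => v _; case: ifP => // Pv; rewrite mcoeffZ mcoeffU.
by case: eqP Pv => [->|_ _]; rewrite ?Pu ?mulr0.
Qed.

Section GradedClasses.
Variables (k : fieldType) (A : algType k) (F : filtration A).

Lemma fil_pred_lt i j x : (i < j)%N -> F i x -> fil_pred F j x.
Proof. by case: j => // j lt_ij Fx /=; apply: fil_incr Fx. Qed.

Lemma gr_class_eq i j a b (Fa : F i a) (Fb : F j b) : i = j ->
  fil_pred F i (a - b) -> gr_class Fa = gr_class Fb.
Proof.
move=> eq_ij; case: j / eq_ij Fb => Fb ab; apply/qclassP => n.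
rewrite /= coefB !coefZ !coefXn; case: eqP => [->|_]; first by rewrite !mulr1.
by rewrite !mulr0 subrr; apply: (fil_pred_submod F n).1.
Qed.

Lemma gr_classM i j a b (Fa : F i a) (Fb : F j b) :
  gr_class Fa * gr_class Fb = gr_class (fil_mul Fa Fb).
Proof.
rewrite /gr_class -[LHS]rmorphM; congr (qclass _ _); apply: val_inj => /=.
rewrite -!mul_polyC polyCM exprD -!mulrA; congr (_ * _).
by rewrite -[LHS]commr_polyXn -mulrA -!exprD addnC.
Qed.

Lemma gr_class_lin (K : choiceType) (wt : K -> nat) (a : K -> A)
    (Fa : forall u, F (wt u) (a u)) (y : {malg k[K]}) (p : rees F) :
    lin (fun u => gr_class (Fa u)) y = qclass (gr_ideal F) p ->
  forall w, fil_pred F w (\sum_(u <- msupp y | wt u == w) y@_u *: a u - (rees_val p)`_w).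
Proof.
pose m u := Rees (monomial_subproof (Fa u)).
have -> : lin (fun u => gr_class (Fa u)) y =
    qclass (gr_ideal F) (\sum_(u <- msupp y) y@_u *: m u).
  by rewrite linear_sum; apply: eq_bigr => u _; rewrite linearZ.
move/qclassP => Ip w; have := Ip w; rewrite /= coefB; congr (fil_pred F w (_ - _)).
have -> : rees_val (\sum_(u <- msupp y) y@_u *: m u) =
    \sum_(u <- msupp y) ((y@_u)%:A : A) *: (a u *: 'X^(wt u)).
  by elim/big_rec2: _ => //= u q r _ <-.
rewrite coef_sum [RHS]big_mkcond /=; apply: eq_bigr => u _.
rewrite !coefZ coefXn mulr_algl eq_sym; case: eqP; rewrite ?mulr1 // mulr0.
by rewrite scaler0.
Qed.

End GradedClasses.

(** * Classes of words in gr A(Γ) *)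

Section WordClasses.
Variables (k : fieldType) (G : layered_graph).
Local Notation V := (vertex G).
Local Notation A := (layered_alg k G).
Local Notation F := (weight_fil k G).
Local Notation nword := (nword G).
Local Notation W := {malg k[nword]}.

Lemma length_part_mul i j (x y : A) :
  length_part i x -> length_part j y -> length_part (i + j) (x * y).
Proof.
apply: spanM => _ _ [s [ws ->]] [t [wt ->]]; exists (s ++ t).
by rewrite size_cat ws wt /edge_word big_cat.
Qed.

Lemma length_part_edge e : length_part 1 (edge_class k e : A).
Proof. by apply: span_gen; exists [:: e]; rewrite /edge_word big_seq1. Qed.

Lemma length_part1 : length_part 0 (1 : A).
Proof. by apply: span_gen; exists [::]; rewrite /edge_word big_nil. Qed.

Lemma length_part_submod i : is_submod (@length_part k G i).
Proof. exact: span_submod. Qed.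

Lemma length_part_ehat (v : V) j : length_part j (ehat k v j).
Proof.
elim/vertex_ind: v j => [|v e v0 te _ IHv] [|j]; rewrite ?ehat0; try exact: length_part1.
  by rewrite ehat_gt ?level_star //; apply: (length_part_submod _).1.
rewrite -te ehat_edge -[ehat k (head e) j.+1]scale1r.
by apply: (length_part_submod _).2 => //; apply: (length_part_mul (length_part_edge e)).
Qed.

Lemma length_part_pword u : length_part (degree u) (pword k u : A).
Proof.
elim: u => [|x u IHu].
  by rewrite /degree [pword _ _]big_nil big_nil; apply: length_part1.
by rewrite degree_cons pword_cons; apply: length_part_mul => //; apply: length_part_ehat.
Qed.

Lemma fil_edge e : F (level (tail e)) (edge_class k e).
Proof.
apply: span_gen; exists [:: e]; rewrite /edge_word big_seq1; split=> //.
by rewrite /word_weight big_seq1.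
Qed.

Lemma dist_weightS (v : V) j : (0 < level v)%N ->
  dist_weight v j.+1 = (level v + \sum_(i < j) ((level v).-1 - i))%N.
Proof.
move=> v0; rewrite /dist_weight big_ord_recl subn0; congr (_ + _)%N.
by apply: eq_bigr => i _; rewrite lift0; lia.
Qed.

(** Induction along the distinguished path. With h the head of e_v, the first summand of ê(v,j+1) =
    ê(h,j+1) + e_v ê(h,j) has lower weight, since |h| - j < |v|, and the second leads to e(v,j+1).
    For j > |v|, ê(v,j) is 0 while [dist_elt] is the class of the whole path; hence the
    restriction. *)
Lemma fil_ehat (v : V) j : F (dist_weight v j) (ehat k v j) /\
  ((j <= level v)%N -> fil_pred F (dist_weight v j) (ehat k v j - dist_elt k v j)).
Proof.
have F0 i : F i (0 : A) by exact: (fil_submod F i).1.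
elim/vertex_ind: v j => [|v e v0 te de IHv] [|j].
- rewrite ehat0 /dist_elt take0 /edge_word big_nil subrr /dist_weight big_ord0.
  by split=> [|_]; [exact: weight_fil_one | exact: (fil_pred_submod F 0).1].
- by rewrite level_star ehat_gt ?level_star.
- rewrite ehat0 /dist_elt take0 /edge_word big_nil subrr /dist_weight big_ord0.
  by split=> [|_]; [exact: weight_fil_one | exact: (fil_pred_submod F 0).1].
have lv : level v = (level (head e)).+1 by rewrite -te level_edge.
have -> : dist_elt k v j.+1 = edge_class k e * dist_elt k (head e) j.
  by rewrite /dist_elt de /= /edge_word big_cons.
have wE : dist_weight v j.+1 = (level v + dist_weight (head e) j)%N.
  by rewrite dist_weightS lv.
have Fh : fil_pred F (dist_weight v j.+1) (ehat k (head e) j.+1).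
  case: (ltnP (level (head e)) j.+1) => [lt_j|le_j].
    by rewrite ehat_gt //; apply: (fil_pred_submod _ _).1.
  apply: fil_pred_lt (IHv j.+1).1.
  rewrite wE {1}/dist_weight big_ord_recr /= -/(dist_weight (head e) j).
  by rewrite lv; lia.
have incr w x : fil_pred F w x -> F w x.
  by case: w => [->|w Fx]; [exact: F0 | exact: fil_incr Fx].
rewrite -te ehat_edge te; split=> [|lt_jv].
  rewrite -[ehat k (head e) j.+1]scale1r; apply: (fil_submod F _).2; first exact: incr.
  by rewrite wE -te; apply: fil_mul; [exact: fil_edge | exact: (IHv j).1].
rewrite -addrA -mulrBr -[ehat k (head e) j.+1]scale1r.
apply: (fil_pred_submod F _).2; first exact: Fh.
rewrite wE -te; apply: (fil_pred_mul _ _ _ _ _).1; first exact: fil_edge.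
by apply: (IHv j).2; rewrite -ltnS -lv.
Qed.

Definition dword (u : seq (V * nat)) : A := \prod_(x <- u) dist_elt k x.1 x.2.

Lemma fil_pword u : F (weight u) (pword k u).
Proof.
elim: u => [|x u IHu].
  by rewrite [pword _ _]big_nil /weight big_nil; exact: weight_fil_one.
by rewrite pword_cons weight_cons; apply: fil_mul => //; exact: (fil_ehat _ _).1.
Qed.

Lemma fil_dword u : F (weight u) (dword u).
Proof.
elim: u => [|x u IHu].
  by rewrite [dword _]big_nil /weight big_nil; exact: weight_fil_one.
by rewrite [dword _]big_cons weight_cons; apply: fil_mul => //; exact: dist_elt_fil.
Qed.

Lemma pword_dword u : all (@letter G) u -> fil_pred F (weight u) (pword k u - dword u).
Proof.
elim: u => [_|x u IHu /andP[/andP[_ /andP[_ lx]] /IHu Iu]].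
  by rewrite [pword _ _]big_nil [dword _]big_nil subrr; apply: (fil_pred_submod F _).1.
rewrite pword_cons [dword _]big_cons weight_cons.
set p := ehat _ _ _; set d := dist_elt _ _ _.
have -> : p * pword k u - d * dword u = 1 *: (p * (pword k u - dword u)) + (p - d) * dword u.
  by rewrite scale1r mulrBr mulrBl addrA subrK.
apply: (fil_pred_submod F _).2.
  by apply: (fil_pred_mul _ _ _ _ _).1 => //; exact: (fil_ehat _ _).1.
by apply: (fil_pred_mul _ _ _ _ _).2; [exact: (fil_ehat _ _).2 | exact: fil_dword].
Qed.

Definition gword (u : seq (V * nat)) : gr_alg k G := gr_class (fil_pword u).

Lemma prod_gr_dist_elt u : all (@letter G) u ->
  \prod_(y <- u) gr_dist_elt k y.1 y.2 = gword u.
Proof.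
move=> lu; transitivity (gr_class (fil_dword u)); last first.
  apply/esym/gr_class_eq => //; exact: pword_dword.
elim: u {lu} => [|x u IHu].
  rewrite big_nil; apply/qclassP => i /=.
  rewrite coefB coef1 coefZ coefXn /weight big_nil [dword _]big_nil mul1r subrr.
  exact: (fil_pred_submod _ i).1.
rewrite big_cons IHu /gr_dist_elt gr_classM; apply: gr_class_eq; first by rewrite weight_cons.
by rewrite [dword (_ :: _)]big_cons subrr; apply: (fil_pred_submod F _).1.
Qed.

(** The component of [p] in the weight of [u] differs from the terms of [y] of that weight by an
    element [D] of lower filtration. For large N the normal form of [D] has only words of weight
    below that of [u], so [u] has the same coefficient in [y] as in the normal form of the
    component. *)
Lemma gword_coef (y : W) (p : rees F) (u : nword) :
    lin (fun u : nword => gword (val u)) y = qclass (gr_ideal F) p ->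
    (forall N, (2 < N)%N -> u \notin msupp (nf N (rees_val p)`_(weight (val u)))) ->
  y@_u = 0.
Proof.
move/gr_class_lin => /(_ (weight (val u))); set D := _ - _ => FD pu.
have [N [N3 lt_N]] : exists N, (2 < N)%N /\
    forall u', u' \in msupp (nf N D) -> (weight (val u') < weight (val u))%N.
  move: FD; case: (weight _) => [/= ->|w /nf_weight_fil[N0 N0P]].
    by exists 3; split=> // u'; rewrite nf0 // msupp0.
  by exists (N0 + 3)%N; split=> [|u']; [lia | apply: N0P; lia].
apply/eqP; rewrite mcoeff_eq0; apply/negP => uy.
suff /lt_N : u \in msupp (nf N D) by rewrite ltnn.
have := pu N N3; rewrite -mcoeff_eq0 -mcoeff_neq0 => /eqP pu0.
rewrite nfB // nf_lin_comb // mcoeffB pu0 subr0.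
rewrite (mcoeff_sum_cond y (P := fun v : nword => weight (val v) == weight (val u))) //.
by rewrite mcoeff_neq0.
Qed.

End WordClasses.

(** * Counting words *)

Lemma uniq_flatten_cons (T : eqType) (r : seq T) (s : T -> seq (seq T)) :
  uniq r -> (forall x, uniq (s x)) -> uniq (flatten [seq [seq x :: u | u <- s x] | x <- r]).
Proof.
move=> + us; elim: r => //= x r IHr /andP[xr ur]; rewrite cat_uniq IHr // andbT.
rewrite map_inj_uniq; last by move=> u v [].
rewrite us /=; apply/hasPn => z /flatten_mapP[y yr].
by case/mapP => u _ ->; apply/negP => /mapP[v _ [eq_yx _]]; rewrite -eq_yx yr in xr.
Qed.

Section WordLists.
Variables (G : layered_graph) (P : pred (vertex G)).
Local Notation V := (vertex G).
Local Notation L := (V * nat)%type.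

Definition verts : seq V := [seq v <- enum V | P v && (v != star G)].

Definition letters : seq L := [seq (v, j) | v <- verts, j <- iota 1 (level v)].

Lemma mem_letters x : (x \in letters) = P x.1 && letter x.
Proof.
case: x => v j; apply/allpairsPdep/idP => [[w [i [wV ij [-> ->]]]]|/and3P[/= Pv v0 jv]].
  move: wV ij; rewrite mem_filter mem_enum mem_iota => /andP[/andP[Pw w0] _] ij.
  by rewrite /letter /= Pw w0; lia.
by exists v, j; rewrite mem_filter mem_enum mem_iota Pv v0; split=> //; lia.
Qed.

Lemma letters_uniq : uniq letters.
Proof.
apply: allpairs_uniq_dep; first by rewrite filter_uniq ?enum_uniq.
- by move=> v _; apply: iota_uniq.
- by move=> [v i] [w j] _ _ /= [-> ->].
Qed.

Fixpoint words_rec (f m : nat) : seq (seq L) :=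
  if f is f'.+1 then
    if m == 0%N then [:: [::]] else
    flatten [seq [seq x :: u | u <- [seq u <- words_rec f' (m - x.2) | head_ok x u]]
            | x <- [seq x <- letters | (x.2 <= m)%N]]
  else [::].

Definition words (m : nat) : seq (seq L) := words_rec m.+1 m.

Definition word_in (u : seq L) : bool := all (fun x => P x.1) u && normal u.

Lemma mem_words_rec f m u : (m < f)%N ->
  (u \in words_rec f m) = word_in u && (degree u == m).
Proof.
elim: f m u => // f IHf [|m] u lt_mf /=.
  rewrite inE; case: u => [|x u] /=; first by rewrite /word_in /degree big_nil.
  rewrite degree_cons /word_in normal_cons.
  case lx: (letter x); rewrite ?andbF //; case/and3P: lx => _ x2 _.
  by rewrite addn_eq0 eqn0Ngt x2 andbF.
apply/flatten_mapP/idP => [[x]|].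
  rewrite mem_filter mem_letters => /and3P[le_xm Px lx] /mapP[v].
  rewrite mem_filter => /andP[hv]; rewrite IHf; last by case/and3P: lx; lia.
  case/andP=> /andP[Pv nv] /eqP dv ->; rewrite degree_cons dv subnKC // eqxx andbT.
  by rewrite /word_in normal_cons /= Px Pv lx hv nv.
case: u => [|x u]; first by rewrite /degree big_nil andbF.
rewrite degree_cons /word_in normal_cons /=.
case/andP=> /andP[/andP[Px Pu] /and3P[lx hx nu]] /eqP dm.
exists x; first by rewrite mem_filter mem_letters Px lx andbT; lia.
apply/mapP; exists u => //; rewrite mem_filter hx IHf; last by case/and3P: lx; lia.
by rewrite /word_in Pu nu /=; lia.
Qed.

Lemma mem_words m u : (u \in words m) = word_in u && (degree u == m).
Proof. exact: mem_words_rec. Qed.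

Lemma words_rec_uniq f m : uniq (words_rec f m).
Proof.
elim: f m => // f IHf m /=; case: ifP => // _.
apply: uniq_flatten_cons => [|x]; first by rewrite filter_uniq // letters_uniq.
by rewrite filter_uniq.
Qed.

Lemma words_uniq m : uniq (words m).
Proof. exact: words_rec_uniq. Qed.

Lemma words_rec_perm f m : (m < f)%N -> perm_eq (words_rec f m) (words m).
Proof.
move=> lt_mf; apply: uniq_perm; rewrite ?words_rec_uniq // => u.
by rewrite mem_words mem_words_rec.
Qed.

Definition starting (x : L) (m : nat) : nat :=
  if (x.2 <= m)%N then count (head_ok x) (words (m - x.2)) else 0.

Lemma count_words (a : pred (seq L)) (b : pred L) m :
    (0 < m)%N -> (forall x u, a (x :: u) = b x) ->
  count a (words m) = (\sum_(x <- letters | b x) starting x m)%N.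
Proof.
case: m => // m _ ab; rewrite /words /= count_flatten -map_comp sumnE big_map big_filter.
rewrite big_mkcond [RHS]big_mkcond; apply: eq_big_seq => x xL.
rewrite /starting; case: ifP => le_xm; last by case: ifP.
rewrite /= count_map (eq_count (a2 := fun=> b x)) => [|u]; last by rewrite /= ab.
have x2 : (0 < x.2)%N by move: xL; rewrite mem_letters => /and3P[_ _ /andP[]].
case: (b x); rewrite ?count_pred0 // count_predT size_filter.
have /seq.permP -> // : perm_eq (words_rec m.+1 (m.+1 - x.2)) (words (m.+1 - x.2)).
by apply: words_rec_perm; lia.
Qed.

Lemma size_words0 : size (words 0) = 1%N.
Proof. by []. Qed.

Lemma size_words m : (0 < m)%N -> size (words m) = (\sum_(x <- letters) starting x m)%N.
Proof. by move=> m0; rewrite -count_predT (count_words (b := predT)). Qed.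

Lemma starting_eq x m : (x.2 <= m)%N -> letter x ->
  size (words (m - x.2)) =
    (starting x m + \sum_(y <- letters | covers x y) starting y (m - x.2))%N.
Proof.
move=> le_xm lx; rewrite {1}/starting le_xm -(count_predC (head_ok x)); congr (_ + _)%N.
case: (posnP (m - x.2)) => [->|lt_xm].
  rewrite /= big_seq_cond big1 // => y; rewrite mem_letters.
  case/andP=> /and3P[_ _ /andP[y2 _]] _.
  by rewrite /starting leqNgt y2.
by apply: count_words => // y u; rewrite /= negbK.
Qed.

End WordLists.

(** * Polynomials modulo t^(n+1) *)

Section Congruence.
Variables (R : comNzRingType) (n : nat).
Implicit Types p q r : {poly R}.

Definition eqm p q : Prop := forall i, (i <= n)%N -> p`_i = q`_i.

Lemma eqm_trans p q r : eqm p q -> eqm q r -> eqm p r.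
Proof. by move=> pq qr i le_in; rewrite pq ?qr. Qed.

Lemma eqmD p q p' q' : eqm p q -> eqm p' q' -> eqm (p + p') (q + q').
Proof. by move=> pq pq' i le_in; rewrite !coefD pq ?pq'. Qed.

Lemma eqmN p q : eqm p q -> eqm (- p) (- q).
Proof. by move=> pq i le_in; rewrite !coefN pq. Qed.

Lemma eqmMl r p q : eqm p q -> eqm (r * p) (r * q).
Proof.
move=> pq i le_in; rewrite !coefM; apply: eq_bigr => j _; rewrite pq //.
exact: leq_trans (leq_subr _ _) le_in.
Qed.

Lemma eqm_sum (I : eqType) (s : seq I) (P : pred I) (F F' : I -> {poly R}) :
  (forall i, i \in s -> P i -> eqm (F i) (F' i)) ->
  eqm (\sum_(i <- s | P i) F i) (\sum_(i <- s | P i) F' i).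
Proof.
move=> FF' i le_in; rewrite !coef_sum big_seq_cond [RHS]big_seq_cond.
by apply: eq_bigr => j /andP[js Pj]; apply: FF'.
Qed.

End Congruence.

(** * Signed sums over chains *)

Section Chains.
Variables (G : layered_graph) (P : pred (vertex G)).
Local Notation V := (vertex G).

(** The signed sum over the chains with [l] further elements after [v], built from the first step;
    the exponents telescope. The predicate [P] concerns the elements after [v]. *)
Fixpoint chains (l : nat) (v : V) : {poly int} :=
  if l is l'.+1 then
    - \sum_(w | P w && above v w) 'X^(level v - level w) * chains l' w
  else 1.

Lemma path_level (v : V) (c : seq V) : path (@above G) v c -> (level (last v c) <= level v)%N.
Proof.
elim: c v => //= w c IHc v /andP[/above_level vw /IHc].
by move/leq_trans; apply; apply: ltnW.
Qed.

Lemma chainsE l v : chains l v =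
  \sum_(c : l.-tuple V | path (@above G) v c && all P c)
     (-1) ^+ l * 'X^(level v - level (last v c)).
Proof.
elim: l v => [|l IHl] v.
  rewrite (big_pred1 [tuple]) /= => [|c]; last by rewrite tuple0 /= eqxx.
  by rewrite subnn expr0 mulr1.
rewrite [RHS]big_mkcond /=.
pose F x (c : l.-tuple V) : {poly int} :=
  if path (@above G) v (x :: c) && all P (x :: c) then
    (-1) ^+ l.+1 * 'X^(level v - level (last v (x :: c))) else 0.
transitivity (\sum_(t : l.+1.-tuple V) F (thead t) [tuple of behead t]); last first.
  by apply: eq_bigr => t _; case/tupleP: t => x c; rewrite /F theadE.
rewrite (sum_tuple_cons F) /= -sumrN big_mkcond; apply: eq_bigr => w _.
rewrite /F /= IHl; case: ifP => [/andP[Pw vw]|nPw]; last first.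
  by rewrite big1 // => c _; rewrite andbACA [above v w && _]andbC nPw.
rewrite vw Pw /= mulr_sumr -sumrN [LHS]big_mkcond; apply: eq_bigr => c _.
case: ifP => // /andP[/path_level wc _].
have -> : (level v - level (last w c) = (level v - level w) + (level w - level (last w c)))%N.
  by have := above_level vw; lia.
by rewrite exprD exprS; ring.
Qed.

(** Levels strictly decrease along a chain, so its l + 1 vertices are distinct. *)
Lemma chains_eq0 l (v : V) : (#|V| <= l)%N -> chains l v = 0.
Proof.
move=> le_Vl; rewrite chainsE big1 // => c /andP[vc _].
have /card_uniqP cu : uniq (v :: c).
  apply: (sorted_uniq (leT := @above G)) => // [u w x|w]; first exact: above_trans.
  by apply/idP => /above_level; rewrite ltnn.
have := max_card (mem (v :: c)); rewrite cu /= size_tuple => /leq_trans/(_ le_Vl).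
by rewrite ltnn.
Qed.

Definition chain_sum (v : V) : {poly int} := \sum_(l < #|V|) chains l v.

(** Chains are sorted by their second element. Adding the zero term l = [#|V|] makes the shift of
    [l] exact. *)
Lemma chain_sumE (v : V) :
  chain_sum v = 1 - \sum_(w | P w && above v w) 'X^(level v - level w) * chain_sum w.
Proof.
have -> : chain_sum v = \sum_(l < #|V|.+1) chains l v.
  by rewrite big_ord_recr /= chains_eq0 // addr0.
rewrite big_ord_recl; congr (_ + _); rewrite -sumrN.
under eq_bigr => l _ do rewrite lift0 /= -sumrN.
rewrite exchange_big; apply: eq_bigr => w _ /=.
by rewrite /chain_sum mulr_sumr -sumrN.
Qed.

Lemma fixed_chain_sumE :
  \sum_(l < #|V|) \sum_(c : l.+1.-tuple V | all P c && sorted (@above G) c)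
      (-1) ^+ l * 'X^(level (thead c) - level (last (thead c) c)) =
  \sum_(v | P v) chain_sum v :> {poly int}.
Proof.
rewrite exchange_big /=; apply: eq_bigr => l _.
under [RHS]eq_bigr => v _ do rewrite chainsE.
rewrite [LHS]big_mkcond [RHS]big_mkcond /=.
pose F x (c : l.-tuple V) : {poly int} :=
  if all P (x :: c) && path (@above G) x c then
    (-1) ^+ l * 'X^(level x - level (last x c)) else 0.
transitivity (\sum_(t : l.+1.-tuple V) F (thead t) [tuple of behead t]).
  by apply: eq_bigr => t _; case/tupleP: t => x c; rewrite /F theadE.
rewrite (sum_tuple_cons F); apply: eq_bigr => v _; rewrite /F /=.
case: (P v) => /=; last by rewrite big1.
by rewrite [RHS]big_mkcond; apply: eq_bigr => c _; rewrite andbC.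
Qed.

End Chains.

(** * The generating function of the words *)

Section GeneratingFunction.
Variables (G : layered_graph) (P : pred (vertex G)).
Hypothesis P_star : P (star G).
Local Notation V := (vertex G).
Local Notation verts := (verts P).
Local Notation words := (words P).
Local Notation chain_sum := (chain_sum P).

Definition starting_at (v : V) (m : nat) : nat :=
  \sum_(j <- iota 1 (level v)) starting P (v, j) m.

Lemma starting_at0 v : starting_at v 0 = 0%N.
Proof.
rewrite /starting_at big_seq big1 // => j; rewrite mem_iota /starting /=.
by case: j.
Qed.

Lemma size_words_starting m : (0 < m)%N ->
  size (words m) = (\sum_(v <- verts) starting_at v m)%N.
Proof. by move=> m0; rewrite size_words // big_allpairs_dep. Qed.

(** This sums [starting_eq] over j. A letter (v,j) covers (w,l) only for j = |v| - |w|, whatever l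
    is, so the excluded words are grouped by [w]. *)
Lemma starting_atE (v : V) m : v \in verts ->
  (starting_at v m + \sum_(w <- verts | above v w)
     (if (level v - level w <= m)%N then starting_at w (m - (level v - level w)) else 0) =
   \sum_(j <- iota 1 (level v)) (if (j <= m)%N then size (words (m - j)) else 0))%N.
Proof.
rewrite mem_filter => /andP[/andP[Pv v0] _]; rewrite /starting_at.
pose D w j : nat := if (j <= m)%N then starting_at w (m - j) else 0.
transitivity (\sum_(j <- iota 1 (level v)) (starting P (v, j) m +
   \sum_(w <- verts | above v w) (if j == (level v - level w)%N then D w j else 0)))%N.
  rewrite big_split /=; congr (_ + _)%N; rewrite exchange_big; apply: eq_bigr => w vw /=.
  rewrite -[RHS]big_mkcond /= -[RHS]big_filter.
  rewrite (@filter_pred1_uniq _ _ (level v - level w)%N) ?iota_uniq //.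
    by rewrite big_seq1.
  by rewrite mem_iota; have := above_level vw; lia.
rewrite !big_seq; apply: eq_bigr => j; rewrite mem_iota => jv.
case: ifP => le_jm; last first.
  rewrite /starting /= le_jm big1 ?addn0 // => w _.
  by case: eqP => // _; rewrite /D le_jm.
rewrite (@starting_eq _ P (v, j)) /=; [|done|by rewrite /letter /= v0; lia].
congr (_ + _)%N; rewrite [RHS]big_mkcond big_allpairs_dep /= big_mkcond.
apply: eq_bigr => w _; rewrite /covers /= /D le_jm /starting_at.
case: (above v w) => /=; last by rewrite big1.
by case: eqP => // _; rewrite big1.
Qed.

Variable n : nat.

Let H : {poly int} := \poly_(i < n.+1) (size (words i))%:Z.
Let S v : {poly int} := \poly_(i < n.+1) (starting_at v i)%:Z.

Lemma coef_trunc (f : nat -> int) i : (i <= n)%N -> (\poly_(i < n.+1) f i)`_i = f i.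
Proof. by move=> le_in; rewrite coef_poly ltnS le_in. Qed.

Lemma coef_XnM_trunc (f : nat -> nat) j i : (i <= n)%N ->
  ('X^j * \poly_(i < n.+1) (f i)%:Z : {poly int})`_i =
  (if (j <= i)%N then f (i - j)%N else 0%N)%:Z.
Proof.
move=> le_in; have le_ijn : (i - j <= n)%N by exact: leq_trans (leq_subr _ _) le_in.
by rewrite coefXnM ltnNge coef_trunc //; case: (j <= i)%N.
Qed.

Lemma hilbert_eqm : eqm n H (1 + \sum_(v <- verts) S v).
Proof.
move=> i le_in; rewrite coefD coef1 coef_sum coef_trunc //.
under eq_bigr => v _ do rewrite coef_trunc //.
case: i le_in => [|i] _; first by rewrite size_words0 big1 // => v _; rewrite starting_at0.
by rewrite size_words_starting // add0r; apply: (big_morph _ PoszD).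
Qed.

Lemma starting_eqm v : v \in verts ->
  eqm n (S v) ((\sum_(j <- iota 1 (level v)) 'X^j) * H -
               \sum_(w <- verts | above v w) 'X^(level v - level w) * S w).
Proof.
move=> vV i le_in; rewrite coefB mulr_suml !coef_sum coef_trunc //.
under eq_bigr => j _ do rewrite coef_XnM_trunc //.
under [X in _ - X]eq_bigr => w _ do rewrite coef_XnM_trunc //.
rewrite -!(big_morph _ PoszD (erefl 0%:Z)) /= -(starting_atE i vV) PoszD.
by rewrite addrK.
Qed.

Lemma geometric m :
  (1 - 'X) * (\sum_(j <- iota 1 m) 'X^j : {poly int}) = 'X - 'X^(m.+1).
Proof.
elim: m => [|m IHm]; first by rewrite big_nil mulr0 subrr.
have -> : iota 1 m.+1 = iota 1 m ++ [:: m.+1] by rewrite -[in LHS](addn1 m) iotaD add1n.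
by rewrite big_cat big_seq1 /= mulrDr IHm [in RHS]exprS; ring.
Qed.

Lemma chain_sum_star : chain_sum (star G) = 1.
Proof.
rewrite chain_sumE big1 ?subr0 // => w /andP[_ /above_level].
by rewrite level_star.
Qed.

Lemma sum_verts (F : V -> {poly int}) (Q : pred V) :
  \sum_(w | P w && Q w && (w != star G)) F w = \sum_(w <- verts | Q w) F w.
Proof.
rewrite big_filter_cond big_enum_cond; apply: eq_bigl => w.
by rewrite -!andbA; congr (_ && _); rewrite andbC.
Qed.

(* [(1 - t) G_v = t H Z_v], with [G_v] the series of the words starting at [v] and
   [Z_v] the sum over the chains starting at [v]. *)
Lemma starting_chain_sum v : v \in verts -> eqm n ((1 - 'X) * S v) ('X * H * chain_sum v).
Proof.
move: {2}(level v) (leqnn (level v)) => d; elim/ltn_ind: d v => d IHd v le_vd vV.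
apply: eqm_trans (eqmMl (1 - 'X) (starting_eqm vV)) _.
rewrite mulrBr mulrA geometric mulr_sumr.
have step : eqm n (('X - 'X^((level v).+1)) * H -
      \sum_(w <- verts | above v w) (1 - 'X) * ('X^(level v - level w) * S w))
    (('X - 'X^((level v).+1)) * H -
      \sum_(w <- verts | above v w) 'X^(level v - level w) * ('X * H * chain_sum w)).
  apply: eqmD => //; apply/eqmN/eqm_sum => w wV vw; rewrite mulrCA; apply: eqmMl.
  by apply: IHd (leqnn _) wV; apply: leq_trans (above_level vw) le_vd.
apply: eqm_trans step _.
move=> i _; congr (polyseq _)`_i.
have v0 : v != star G by move: vV; rewrite mem_filter => /andP[/andP[]].
(* The star is not in [verts]. Its summand is t^|v|, as Z is 1 there, and it accounts for the
   t^(|v|+1) of the geometric sum. *)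
rewrite [in RHS]chain_sumE (bigD1 (star G)) /=; last by rewrite P_star above_star.
rewrite sum_verts level_star subn0 chain_sum_star.
under eq_bigr => w _ do rewrite mulrCA.
by rewrite -mulr_sumr exprS; ring.
Qed.

(** Since Z is 1 at the star, the left side is (1 - t) H - Σ t H Z_v = (1 - t) (H - Σ G_v) with v in
    [verts], and H - Σ G_v = 1. *)
Lemma words_gf : eqm n (H * (1 - 'X * \sum_(v | P v) chain_sum v)) (1 - 'X).
Proof.
rewrite (bigD1 (star G)) //= chain_sum_star.
have -> : \sum_(v | P v && (v != star G)) chain_sum v = \sum_(v <- verts) chain_sum v.
  rewrite -(sum_verts _ predT); apply: eq_bigl => v; by rewrite andbT.
have -> : H * (1 - 'X * (1 + \sum_(v <- verts) chain_sum v)) =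
    (1 - 'X) * H - \sum_(v <- verts) 'X * H * chain_sum v.
  by rewrite -mulr_sumr; ring.
have step : eqm n ((1 - 'X) * H - \sum_(v <- verts) 'X * H * chain_sum v)
    ((1 - 'X) * (1 + \sum_(v <- verts) S v) - \sum_(v <- verts) (1 - 'X) * S v).
  apply: eqmD; first exact/eqmMl/hilbert_eqm.
  by apply/eqmN/eqm_sum => v vV _ i le_in; rewrite -starting_chain_sum.
apply: eqm_trans step _.
by move=> i _; congr (polyseq _)`_i; rewrite -mulr_sumr; ring.
Qed.

Lemma words_expansion :
  \sum_(i < n.+1) (size (words i))%:Z * (1 - 'X * \sum_(v | P v) chain_sum v)`_(n - i) =
  (1 - 'X : {poly int})`_n.
Proof.
rewrite -words_gf // coefM; apply: eq_bigr => i _; rewrite coef_trunc //.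
by rewrite -ltnS.
Qed.

End GeneratingFunction.

(** * Bases, automorphisms and traces *)

Section WordBases.
Variables (k : fieldType) (G : layered_graph) (M : lmodType k).
Local Notation L := (vertex G * nat)%type.
Local Notation nword := (nword G).
Local Notation W := {malg k[nword]}.
Variables (f : {linear W -> M}) (S : M -> Prop) (ws : seq (seq L)).
Hypothesis S_submod : is_submod S.
Hypothesis ws_uniq : uniq ws.
Hypothesis ws_normal : forall u, u \in ws -> normal u.
Hypothesis ws_S : forall u, u \in ws -> S (f (word k u)).

Lemma mcoeff_word (u : seq L) (v : nword) : normal u -> (word k u)@_v = (u == val v)%:R.
Proof. by move=> nu; rewrite (word_normal k nu) mcoeffU -val_eqE. Qed.

Lemma words_basis :
    (forall x, S x -> exists2 y, x = f y & forall u, u \in msupp y -> val u \in ws) ->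
    (forall y : W, (forall u : nword, u \in msupp y -> val u \in ws) -> f y = 0 -> y = 0) ->
  is_basis S (fun j : 'I_(size ws) => f (word k (nth [::] ws j))).
Proof.
move=> S_f f_inj; have ws_nth (j : 'I_(size ws)) : nth [::] ws j \in ws by exact: mem_nth.
pose nw (j : 'I_(size ws)) : nword :=
  exist (fun u => normal u) (nth [::] ws j) (ws_normal (ws_nth j)).
have coefE c (v : nword) : (\sum_(i < size ws) c i *: word k (nth [::] ws i))@_v =
    \sum_(i < size ws) c i * (nth [::] ws i == val v)%:R.
  rewrite raddf_sum; apply: eq_bigr => i _.
  by apply: etrans (mcoeffZ _ _ _) _; rewrite mcoeff_word // ws_normal.
have coef c (j : 'I_(size ws)) (v : nword) : val v = nth [::] ws j ->
    (\sum_(i < size ws) c i *: word k (nth [::] ws i))@_v = c j.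
  move=> vE; rewrite coefE (bigD1 j) //= vE eqxx mulr1 big1 ?addr0 // => i neq_ij.
  by rewrite nth_uniq // val_eqE (negbTE neq_ij) mulr0.
have coef0 c (v : nword) : val v \notin ws ->
    (\sum_(i < size ws) c i *: word k (nth [::] ws i))@_v = 0.
  move=> vws; rewrite coefE big1 // => i _; case: eqP vws => [<-|_ _]; last exact: mulr0.
  by rewrite ws_nth.
split=> [c c0 j|x].
  rewrite -(coef c j (nw j)) //; set y := \sum_(i < size ws) _.
  suff -> : y = 0 by rewrite mcoeff0.
  apply: f_inj; last by rewrite -[RHS]c0 linear_sum; apply: eq_bigr => i _; rewrite linearZ.
  by move=> u; apply: contraLR => uws; rewrite -mcoeff_eq0 coef0.
split=> [/S_f[y -> yws]|[c ->]]; last first.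
  have [S0 SL] := S_submod; apply: big_ind => // [x1 x2 S1 S2|i _].
    by rewrite -[x1]scale1r; apply: SL.
  by rewrite -[_ *: _]addr0; apply: SL => //; apply: ws_S.
exists (fun j => y@_(nw j)).
transitivity (f (\sum_(j < size ws) y@_(nw j) *: word k (nth [::] ws j))).
  congr (f _); apply/malgP => v; case: (boolP (val v \in ws)) => [/(nthP [::])[j lt_j ej]|vws].
    rewrite (coef _ (Ordinal lt_j)) //; by congr (mcoeff _ _); apply: val_inj; rewrite /= ej.
  rewrite coef0 //; apply/eqP; rewrite mcoeff_eq0.
  by apply: contra vws; apply: yws.
by rewrite linear_sum; apply: eq_bigr => i _; rewrite linearZ.
Qed.

End WordBases.

(** * Word bases of A(Γ)_[i] and A(Γ^σ)_[i] *)

Section Bases.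
Variables (k : fieldType) (G : layered_graph).
Local Notation V := (vertex G).
Local Notation L := (V * nat)%type.
Local Notation nword := (nword G).
Local Notation W := {malg k[nword]}.

Lemma nf_theta N (y : W) : (2 < N)%N -> nf N (theta k G y) = y.
Proof.
move=> N3; elim/malg_ind: y => [|u].
  split=> [|c x y ex ey]; first by rewrite raddf0 nf0.
  rewrite (linearP (theta k G)); apply: etrans (nf_linear N3 _ _ _) _.
  exact: (congr2 (fun a b => c *: a + b) ex ey).
by rewrite thetaU nf_pword ?word_val //; exact: (valP u).
Qed.

Lemma length_part_basis i : is_basis (@length_part k G i)
  (fun j : 'I_(size (words (predT : pred V) i)) =>
     theta k G (word k (nth [::] (words predT i) j))).
Proof.
have wsE (u : seq L) : (u \in words predT i) = normal u && (degree u == i).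
  by rewrite mem_words /word_in all_predT.
have N3 : (2 < 3)%N by [].
apply: words_basis; first exact: length_part_submod.
- exact: words_uniq.
- by move=> u; rewrite wsE => /andP[].
- move=> u; rewrite wsE => /andP[nu /eqP <-]; rewrite theta_word //.
  exact: length_part_pword.
- move=> x xi; exists (nf 3 x); first by rewrite theta_nf.
  by move=> u ux; rewrite wsE (nf_length_part N3 xi ux) eqxx andbT; exact: (valP u).
by move=> y _ y0; rewrite -(nf_theta y N3) y0 nf0.
Qed.

Variable s : {perm V}.

Lemma fixed_wordE u : fixed_word s u = word_in (fixed s) u.
Proof.
by rewrite /fixed_word /word_in /normal andbA -all_predI; congr (_ && _); apply: eq_all.
Qed.

Lemma gr_length_part_submod i : is_submod (@gr_length_part k G i).
Proof.
split.
  exists 0; split=> [w|]; last by rewrite raddf0.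
  by rewrite coef0; exact: (length_part_submod k G i).1.
move=> c _ _ [p [pi ->]] [q [qi ->]]; exists (c *: p + q); split=> [w|].
  by rewrite coefD coefZ mulr_algl; exact: (length_part_submod k G i).2.
by rewrite -qclass_linear.
Qed.

Lemma fixed_alg_part_submod i : is_submod (@fixed_alg_part k G s i).
Proof.
have [f0 fL] : is_submod (@fixed_alg k G s) by exact: span_submod.
have [g0 gL] := gr_length_part_submod i.
by split=> [|c x y [xf xg] [yf yg]]; split; [| | exact: fL | exact: gL].
Qed.

Definition gr_lin : {linear W -> gr_alg k G} := linext (fun u : nword => gword k (val u)).

Lemma gr_lin_word u : normal u -> gr_lin (word k u) = gword k u.
Proof. by move=> nu; rewrite (word_normal k nu) /gr_lin linextU. Qed.

Lemma fixed_alg_gr_lin x : @fixed_alg k G s x ->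
  exists2 y, x = gr_lin y & forall u, u \in msupp y -> word_in (fixed s) (val u).
Proof.
move: x; apply: span_min => [|_ [u [us ->]]].
  split=> [|c _ _ [y -> ys] [z -> zs]].
    by exists 0; [rewrite raddf0 | move=> u; rewrite msupp0].
  exists (c *: y + z); first by rewrite linearP.
  move=> u /(fsubsetP (msuppD_le _ _)); rewrite in_fsetU => /orP[|/zs//].
  by move/(fsubsetP (msuppZ_le _ _)) => /ys.
have wu : word_in (fixed s) u by rewrite -fixed_wordE.
have nu : normal u by case/andP: wu.
have lu : all (@letter G) u by case/andP: nu.
exists (word k u); first by rewrite gr_lin_word // prod_gr_dist_elt.
move=> v; rewrite (word_normal k nu) msuppU oner_eq0 in_fset1 => /eqP ->; exact: wu.
Qed.

(** [gword_coef] serves twice. A representative with components in A(Γ)_[i] has normal forms of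
    degree [i] only, which rules out words of other degrees; the representative 0 gives
    independence. *)
Lemma fixed_alg_part_basis i : is_basis (@fixed_alg_part k G s i)
  (fun j : 'I_(size (words (fixed s) i)) => gr_lin (word k (nth [::] (words (fixed s) i) j))).
Proof.
apply: words_basis; first exact: fixed_alg_part_submod.
- exact: words_uniq.
- by move=> u; rewrite mem_words => /andP[/andP[]].
- move=> u; rewrite mem_words => /andP[wu /eqP <-]; have nu : normal u by case/andP: wu.
  rewrite gr_lin_word //; split.
    apply: span_gen; exists u; rewrite fixed_wordE wu; split=> //.
    by rewrite prod_gr_dist_elt //; case/andP: nu.
  exists (Rees (monomial_subproof (fil_pword k u))); split=> // w.
  rewrite coefZ coefXn; case: eqP => _; rewrite ?mulr1 ?mulr0; first exact: length_part_pword.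
  exact: (length_part_submod k G _).1.
- move=> x [/fixed_alg_gr_lin[y -> ys] [p [pi yp]]]; exists y => // u uy.
  rewrite mem_words ys //=; apply: contraLR uy => du; rewrite -mcoeff_eq0; apply/eqP.
  apply: (gword_coef yp) => N N3; apply: contra du => /(nf_length_part N3 (pi _)) ->.
  by rewrite eqxx.
move=> y _ y0; apply/malgP => u; rewrite mcoeff0; apply: (@gword_coef _ _ y 0).
  by rewrite raddf0 -[RHS]y0.
by move=> N N3; rewrite coef0 nf0 // msupp0.
Qed.

End Bases.

(** * The automorphism of A(Γ) induced by σ *)

Section Automorphism.
Variables (k : fieldType) (G : layered_graph).
Local Notation V := (vertex G).
Local Notation E := (edge G).
Local Notation L := (V * nat)%type.
Local Notation A := (layered_alg k G).

Lemma automorphismV (s : {perm V}) : is_automorphism s -> is_automorphism s^-1%g.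
Proof.
move=> [sl sa]; split=> [v|v w]; first by rewrite -{2}(permKV s v) sl.
by rewrite -{2}(permKV s v) -{2}(permKV s w) sa.
Qed.

Lemma automorphism_star (s : {perm V}) : is_automorphism s -> s (star G) = star G.
Proof. by move=> [sl _]; apply/eqP; rewrite -level_eq0 sl level_star. Qed.

Lemma automorphism_above1 (s : {perm V}) v w : is_automorphism s ->
  above v w -> above (s v) (s w).
Proof.
move=> [_ sa]; move: v; apply: above_ind => v u vu [uw|[uw _]].
  by apply: arc_above; rewrite sa -uw.
by apply: above_arc_trans uw; rewrite sa.
Qed.

Lemma automorphism_above (s : {perm V}) v w : is_automorphism s ->
  above (s v) (s w) = above v w.
Proof.
move=> s_aut; apply/idP/idP; last exact: automorphism_above1.
by move/(automorphism_above1 (automorphismV s_aut)); rewrite !permK.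
Qed.

Definition rename (s : {perm V}) (u : seq L) : seq L := [seq (s x.1, x.2) | x <- u].

Lemma degree_rename s u : degree (rename s u) = degree u.
Proof. by rewrite /degree big_map. Qed.

Lemma normal_rename (s : {perm V}) u : is_automorphism s -> normal u -> normal (rename s u).
Proof.
move=> s_aut; have [sl sa] := s_aut; elim: u => //= x u IHu.
rewrite !normal_cons => /and3P[/andP[x0 jx] hx nu]; rewrite IHu // andbT.
rewrite /letter /= sl jx andbT -level_eq0 sl level_eq0 x0 /=.
by case: u hx {nu IHu} => //= y u; rewrite /covers /= !sl automorphism_above.
Qed.

Lemma rename_fixed s u : (rename s u == u) = all (fun x => fixed s x.1) u.
Proof.
elim: u => //= -[v j] u IHu; rewrite eqseq_cons IHu; congr (_ && _).
by rewrite /fixed xpair_eqE eqxx andbT.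
Qed.

Section Lift.
Variable s : {perm V}.
Hypothesis s_aut : is_automorphism s.

(** Parallel edges have the same class, so the choice among them does not affect the class;
    [edge_imageP] shows that a suitable edge is always found. *)
Definition edge_image (e : E) : E :=
  odflt e [pick f | (tail f == s (tail e)) && (head f == s (head e))].

Lemma edge_imageP e : tail (edge_image e) = s (tail e) /\ head (edge_image e) = s (head e).
Proof.
rewrite /edge_image; case: pickP => [f /andP[/eqP-> /eqP->]//|nof].
have : arc (s (tail e)) (s (head e)) by rewrite s_aut.2; apply/arcP; exists e.
by move/arcP => [f [tf hf]]; have := nof f; rewrite tf hf !eqxx.
Qed.

Lemma path_image (p : seq E) v w : is_path p v w -> is_path (map edge_image p) (s v) (s w).
Proof.
elim: p v => // e p IHp v; rewrite map_cons !is_path_cons.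
have [-> ->] := edge_imageP e => /andP[/eqP <-]; rewrite eqxx /=.
by case: p IHp => [_ /eqP-> /=|f p IHp]; [rewrite eqxx | exact: IHp].
Qed.

Definition free_image : {lrmorphism free_algT k G -> A} :=
  free_ext (fun e => edge_class k (edge_image e)).

Lemma free_imageD x y : free_image (x + y) = free_image x + free_image y.
Proof. exact: rmorphD. Qed.

Lemma free_imageB x y : free_image (x - y) = free_image x - free_image y.
Proof. exact: rmorphB. Qed.

Lemma free_imageM x y : free_image (x * y) = free_image x * free_image y.
Proof. exact: rmorphM. Qed.

Lemma free_image_gen e : free_image (gen k e) = edge_class k (edge_image e).
Proof.
have := free_ext_prod (fun e => edge_class k (edge_image e)) [:: e].
by rewrite !big_seq1.
Qed.

Lemma free_image_psum p j : free_image (psum k p j) = path_class k (map edge_image p) j.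
Proof.
elim: p j => [|e p IHp] [|j]; rewrite ?psum0 ?path_class0 ?rmorph1 //.
  by rewrite psum_nil path_class_gt // raddf0.
by rewrite psum_cons path_class_cons free_imageD free_imageM !IHp free_image_gen.
Qed.

Lemma free_image_relator x : relator_ideal k G x -> free_image x = 0.
Proof.
move: x; apply: span_min => [|_ [a [r [b [[p [q [v [w [j [pP qP _ ->]]]]]] ->]]]]].
  split=> [|c x y ex ey]; first exact: raddf0.
  apply: etrans (free_ext_linear _ c x y) _.
  by apply: etrans (congr2 (fun a b => c *: a + b) ex ey) _; rewrite scaler0 addr0.
change (free_image
  ((a : free_algT k G) * (psum k p j - psum k q j) * (b : free_algT k G)) = 0).
rewrite !free_imageM free_imageB !free_image_psum.
by rewrite (path_class_eq k j (path_image pP) (path_image qP)) subrr mulr0 mul0r.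
Qed.

Definition aut_alg : {lrmorphism A -> A} := quot_lrmorphism free_image_relator.

Lemma aut_algD x y : aut_alg (x + y) = aut_alg x + aut_alg y.
Proof. exact: rmorphD. Qed.

Lemma aut_algM x y : aut_alg (x * y) = aut_alg x * aut_alg y.
Proof. exact: rmorphM. Qed.

Lemma aut_alg1 : aut_alg 1 = 1.
Proof. exact: rmorph1. Qed.

Lemma aut_alg_linear : linear aut_alg.
Proof. exact: (quot_lift_linear free_image_relator). Qed.

Lemma aut_alg_edge e : aut_alg (edge_class k e) = edge_class k (edge_image e).
Proof.
apply: etrans (quot_liftE free_image_relator (gen k e)) _.
exact: free_image_gen.
Qed.

Lemma edge_class_eq (e f : E) : tail e = tail f -> head e = head f ->
  edge_class k e = edge_class k f.
Proof. by rewrite !edge_class_ehat => -> ->. Qed.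

(** The image of a distinguished path need not be distinguished, but [ehat_edge] holds for every
    edge. This is why the trace is computed in words in the ê(v,j). *)
Lemma aut_alg_ehat v j : aut_alg (ehat k v j) = ehat k (s v) j.
Proof.
elim/vertex_ind: v j => [|v e v0 te _ IHv] [|j]; rewrite ?ehat0 ?aut_alg1 //.
  by rewrite !ehat_gt ?raddf0 ?s_aut.1 ?level_star.
rewrite -te ehat_edge aut_algD aut_algM !IHv aut_alg_edge.
by have [<- <-] := edge_imageP e; rewrite -ehat_edge.
Qed.

Lemma aut_alg_pword u : aut_alg (pword k u) = pword k (rename s u).
Proof.
elim: u => [|x u IHu]; first by rewrite /pword !big_nil aut_alg1.
rewrite pword_cons aut_algM; apply: etrans (congr2 *%R (aut_alg_ehat _ _) IHu) _.
exact: (esym (pword_cons k (s x.1, x.2) (rename s u))).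
Qed.

End Lift.

End Automorphism.

Section Trace.
Variables (k : fieldType) (G : layered_graph).
Local Notation V := (vertex G).
Local Notation E := (edge G).
Local Notation A := (layered_alg k G).
Variable s : {perm V}.
Hypothesis s_aut : is_automorphism s.

Lemma aut_alg_induced (e f : E) : tail f = s (tail e) -> head f = s (head e) ->
  aut_alg k s_aut (edge_class k e) = edge_class k f.
Proof.
move=> tf hf; rewrite aut_alg_edge; have [te he] := edge_imageP s_aut e.
by apply: edge_class_eq; rewrite ?te ?he.
Qed.

Lemma layered_alg_ind (Q : A -> Prop) : is_submod Q ->
  Q 1 -> (forall e x, Q x -> Q (edge_class k e * x)) -> forall x, Q x.
Proof.
move=> [Q0 QL] Q1 QM x; have [a ->] := cls_surj x.
elim/free_alg_ind: a => [|w].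
  by split=> [|c x1 x2 Q1' Q2]; [rewrite raddf0 | rewrite cls_linear; apply: QL].
elim: w => [|e w IHw]; first by rewrite big_nil cls1.
by rewrite big_cons clsM; apply: QM.
Qed.

End Trace.

Lemma aut_algK (k : fieldType) (G : layered_graph) (s t : {perm vertex G})
    (s_aut : is_automorphism s) (t_aut : is_automorphism t) :
  cancel s t -> cancel (aut_alg k s_aut) (aut_alg k t_aut).
Proof.
move=> st; apply: layered_alg_ind.
- split=> [|c x y ex ey]; first by rewrite !raddf0.
  apply: etrans (congr1 (aut_alg k t_aut) (@aut_alg_linear k G s s_aut c x y)) _.
  apply: etrans (@aut_alg_linear k G t t_aut c _ _) _.
  exact: (congr2 (fun a b => c *: a + b) ex ey).
- by rewrite !aut_alg1.
move=> e x ex; apply: etrans (congr1 (aut_alg k t_aut) (@aut_algM k G s s_aut _ _)) _.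
apply: etrans (@aut_algM k G t t_aut _ _) _.
rewrite (aut_alg_edge k s_aut e).
have [te he] := edge_imageP s_aut e.
apply: (congr2 *%R _ ex); apply: aut_alg_induced; by rewrite ?te ?he st.
Qed.

Lemma aut_alg_bij (k : fieldType) (G : layered_graph) (s : {perm vertex G})
    (s_aut : is_automorphism s) : bijective (aut_alg k s_aut).
Proof.
exists (aut_alg k (automorphismV s_aut)); apply: aut_algK.
  exact: permK.
exact: permKV.
Qed.

(** * The trace of the induced automorphism *)

Section TraceFormula.
Variables (k : fieldType) (G : layered_graph) (s : {perm vertex G}).
Hypothesis s_aut : is_automorphism s.
Local Notation V := (vertex G).

Lemma size_fixed_words i :
  size (words (fixed s) i) = count (fun u => rename s u == u) (words (predT : pred V) i).
Proof.
rewrite -size_filter; apply/perm_size/uniq_perm; rewrite ?filter_uniq ?words_uniq //.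
move=> u; rewrite mem_filter !mem_words rename_fixed /word_in all_predT /=.
by rewrite andbA.
Qed.

(** The automorphism permutes the basis of words, so its matrix is a permutation matrix with a
    diagonal 1 for each word equal to its renaming, that is, each word in fixed vertices. *)
Lemma aut_alg_trace i :
  has_trace (@length_part k G i) (aut_alg k s_aut) (size (words (fixed s) i))%:R.
Proof.
set ws := words (predT : pred V) i.
have wsE u : (u \in ws) = normal u && (degree u == i).
  by rewrite mem_words /word_in all_predT.
have ws_uniq : uniq ws by exact: words_uniq.
have ws_nth (j : 'I_(size ws)) : nth [::] ws j \in ws by exact: mem_nth.
have ws_normal (j : 'I_(size ws)) : normal (nth [::] ws j).
  by have := ws_nth j; rewrite wsE => /andP[].
exists (size ws), (fun j : 'I_(size ws) => theta k G (word k (nth [::] ws j))),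
  (\matrix_(j, l) (rename s (nth [::] ws j) == nth [::] ws l)%:R).
split; first exact: length_part_basis.
  move=> j; have sw : rename s (nth [::] ws j) \in ws.
    have := ws_nth j; rewrite !wsE degree_rename => /andP[nw ->].
    by rewrite normal_rename.
  have [l0 lt_l0 El] := nthP [::] sw.
  rewrite (bigD1 (Ordinal lt_l0)) //= mxE El eqxx scale1r big1 => [|l neq_l].
    rewrite addr0 theta_word //.
    apply: etrans (aut_alg_pword k s_aut _) _.
    by rewrite theta_word // ; move: sw; rewrite wsE => /andP[].
  rewrite mxE -El (nth_uniq [::] lt_l0 (ltn_ord l) ws_uniq).
  have -> : (l0 == l) = false; last exact: scale0r.
  by apply/negP => /eqP el; case/eqP: neq_l; apply: val_inj; rewrite /= el.
rewrite size_fixed_words -/ws /mxtrace; under eq_bigr => j _ do rewrite mxE.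
rewrite -sum1_count (big_nth [::]) big_mkord natr_sum [RHS]big_mkcond /=.
by apply: eq_bigr => j _; case: eqP.
Qed.

End TraceFormula.

Theorem theorem5p4 (k : fieldType) (G : layered_graph)
    (s : {perm vertex G}) (s_aut : is_automorphism s) :
  exists h : nat -> nat,
    [/\ forall i : nat, has_dim (@fixed_alg_part k G s i) (h i),
        exists phi : {lrmorphism layered_alg k G -> layered_alg k G},
          induced_automorphism s phi /\
          forall i : nat, has_trace (@length_part k G i) phi (h i)%:R
      & is_expansion (fun i => (h i)%:Z)
          (1 - 'X) (1 - 'X * fixed_chain_sum s)].
Proof.
exists (fun i => size (words (fixed s) i)); split.
- by move=> i; exists (fun j : 'I_(size (words (fixed s) i)) =>
    gr_lin k G (word k (nth [::] (words (fixed s) i) j))); exact: fixed_alg_part_basis.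
- exists (aut_alg k s_aut); split; last by move=> i; exact: aut_alg_trace.
  by split; [exact: aut_alg_bij | exact: aut_alg_induced].
have s_star : fixed s (star G) by rewrite /fixed automorphism_star.
rewrite /fixed_chain_sum fixed_chain_sumE; split.
  by rewrite coefB coef1 coefXM subr0 unitr1.
by move=> n; apply: words_expansion.
Qed.
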